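(* Let $X$ be a set of $n\geq 2$ points in the Euclidean plane. The following algorithm (Algorithm 1; all terms are defined in the context) correctly computes a $(2,1)$-MBSN on $X$ in $O(n^2)$ time. Algorithm 1. Input: $X$. Output: a $(2,1)$-MBSN on $X$. (1) Construct the $2$-RNG $R$ on $X$. (2) Let $L$ be the ordered set of edge-lengths occurring in $R$, ties broken randomly. (3) Let $t$ be a median of $L$ (a binary search on $L$ now commences). (4) Repeat the following until no smaller value of $\max\{r(G_t),t\}$ can be found: (a) construct the block cut forest of $G_t=R(t)$; (b) if $b(G_t)>5$ or $G_t$ is not connected, abandon the current iteration and let $t$ be the median of the next larger interval of the search; (c) otherwise construct $C(G_t)$; if $r(G_t)\leq t$ let $t$ be the next smaller median, else let $t$ be the next larger median. (5) Let $t^*\in L$ be the value that produces the minimum $\max\{r(G_t),t\}$, and let $s^*$ be the centre of $C(G_{t^*})$. (6) Construct a $(2,0)$-MBSN on $X\cup\{s^*\}$ and output it.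
   Context: Graphs are finite, simple and undirected; vertices are points of $\mathbb{R}^2$ and the length of an edge is the Euclidean distance between its endpoints. $\ell_{\max}(G)$ is the length of a longest edge of $G$. A graph is $2$-connected if its vertex-connectivity is at least $2$, with the convention that $K_1$ and $K_2$ are also regarded as $2$-connected. MBSN: given $X$ and $k\geq 0$, a $(2,k)$-MBSN (minimum bottleneck $2$-connected $k$-Steiner network) on $X$ is a $2$-connected graph $N_k$ with vertex set $X\cup S_k$, where $S_k\subset\mathbb{R}^2$ is a set of $k$ additional points (Steiner points), such that $\ell_{\max}(N_k)$ is minimum over all such graphs; both $S_k$ and the edge set are variable. A $(2,0)$-MBSN uses no Steiner points. $2$-RNG: the $2$-relative neighbourhood graph $R$ on $X$ has the edge $e=uv$ if and only if the lune of $e$ (the intersection of the two disks of radius $|e|$ centred at $u$ and $v$) contains, strictly within its boundary, fewer than two points of $X$. $R(t)$ is the subgraph of $R$ with vertex set $X$ and all edges of $R$ of length at most $t$. Blocks: a block of $G$ is a maximal $2$-connected subgraph (isolated vertices and isolated edges count as blocks). The block cut forest of $G$ is its decomposition into blocks, any two of which share at most one vertex, this vertex being a cut-vertex of $G$. A leaf block is a block containing exactly one cut-vertex of $G$; an isolated block is a block containing no cut-vertex of $G$. The interior $Y^*$ of a block $Y$ is the set of its vertices that are not cut-vertices of $G$. $b(G)$ is the number of leaf blocks of $G$ plus twice the number of isolated blocks of $G$. Smallest colour-spanning disk: for a finite set of coloured points, it is a circle of minimum radius that contains at least one point of each colour. $C(G)$ and $r(G)$: if $G$ is connected and not a block, $C(G)$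 is the smallest colour-spanning disk on the union of the interiors of the leaf blocks of $G$, where two vertices have the same colour if and only if they belong to the same leaf block, and $r(G)$ is its radius. If $G$ is $2$-connected, $C(G)$ is the circle centred at the midpoint of an arbitrary edge $e$ of $G$, with $r(G)=\frac12|e|$. Known procedures used as subroutines: the $2$-RNG of $n$ points is constructed in $O(n^2)$ time and has $O(n)$ edges; given it, a $(2,0)$-MBSN is constructed in $O(n\log n)$ time; the block cut forest of a graph with $m$ edges is constructed in $O(m)$ time; a smallest colour-spanning disk of $n$ points with a constant number of colours is found in $O(n\log n)$ time.
   Formalization: The Steiner point is a new vertex whose position may coincide with a point of X (otherwise a (2,1)-MBSN need not exist, e.g. for collinear 0,1,2), and the known 2-RNG and (2,0)-MBSN procedures are assumed to work also when a position occurs twice. *)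

(* Defs.v *)
From HB Require Import structures.
From mathcomp Require Import all_boot all_order all_algebra.
From mathcomp Require Import reals.

Set Implicit Arguments.
Unset Strict Implicit.
Unset Printing Implicit Defensive.

Import Order.TTheory GRing.Theory Num.Theory.

(* The vertex set is a subset of an ambient finite type, so that subgraphs of
   a graph live over the same type. *)
Record graph (V : finType) := Graph {
  verts : {set V};
  adj : rel V;
  adj_sym : symmetric adj;
  adj_irr : irreflexive adj;
  adj_verts : forall u v, adj u v -> u \in verts
}.

Definition subgraph (V : finType) (H G : graph V) : Prop :=
  verts H \subset verts G /\ (forall u v, adj H u v -> adj G u v).

Definition connected (V : finType) (G : graph V) : bool :=
  (verts G != set0) &&
  [forall u in verts G, forall v in verts G, connect (adj G) u v].

Section Deletion.
Context (V : finType) (G : graph V) (S : {set V}).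

Definition del_adj : rel V :=
  fun u v => [&& adj G u v, u \notin S & v \notin S].

Lemma del_adj_sym : symmetric del_adj.
Proof. by move=> u v; rewrite /del_adj adj_sym [(u \notin S) && _]andbC. Qed.

Lemma del_adj_irr : irreflexive del_adj.
Proof. by move=> u; rewrite /del_adj adj_irr. Qed.

Lemma del_adj_verts u v : del_adj u v -> u \in verts G :\: S.
Proof. by case/and3P=> /adj_verts uG uS _; rewrite inE uS. Qed.

Definition del : graph V := Graph del_adj_sym del_adj_irr del_adj_verts.

End Deletion.

(* The vertex-connectivity of G is at least k. *)
Definition kconnected (V : finType) (k : nat) (G : graph V) : Prop :=
  k < #|verts G| /\
  (forall S : {set V}, S \subset verts G -> #|S| < k -> connected (del G S)).

Definition complete (V : finType) (G : graph V) : Prop :=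
  {in verts G &, forall u v, u != v -> adj G u v}.

(* K_1 and K_2 count as 2-connected. *)
Definition two_connected (V : finType) (G : graph V) : Prop :=
  kconnected 2 G \/ (complete G /\ (#|verts G| = 1 \/ #|verts G| = 2)).

Definition is_block (V : finType) (G H : graph V) : Prop :=
  [/\ subgraph H G, two_connected H &
      forall H', subgraph H' G -> two_connected H' -> subgraph H H' ->
        subgraph H' H].

Definition cut_vertex (V : finType) (G : graph V) (v : V) : Prop :=
  v \in verts G /\
  exists u w, [/\ u != v, w != v, u \in verts G, w \in verts G &
    connect (adj G) u w && ~~ connect (adj (del G [set v])) u w].

Definition component (V : finType) (G : graph V) (A : {set V}) : Prop :=
  exists2 u, u \in verts G & A = [set v in verts G | connect (adj G) u v].

(* Edge lists are over the vertices 0, ..., n-1. *)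
Definition edge_list (n : nat) (E : seq (nat * nat)) : bool :=
  uniq E && all (fun e => e.1 < e.2 < n) E.

Section GraphOf.
Context (n : nat) (E : seq (nat * nat)).

Definition list_adj : rel 'I_n := fun i j =>
  (i != j) && (((i : nat, j : nat) \in E) || ((j : nat, i : nat) \in E)).

Lemma list_adj_sym : symmetric list_adj.
Proof. by move=> i j; rewrite /list_adj eq_sym orbC. Qed.

Lemma list_adj_irr : irreflexive list_adj.
Proof. by move=> i; rewrite /list_adj eqxx. Qed.

Lemma list_adj_verts (i j : 'I_n) : list_adj i j -> i \in [set: 'I_n].
Proof. by rewrite inE. Qed.

Definition graph_of : graph 'I_n :=
  Graph list_adj_sym list_adj_irr list_adj_verts.

End GraphOf.

(* E lists every edge of G exactly once. *)
Definition represents (n : nat) (E : seq (nat * nat)) (G : graph 'I_n) : Prop :=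
  edge_list n E /\ adj (graph_of n E) =2 adj G.

Definition dist (R : realType) (p q : R * R) : R :=
  Num.sqrt ((p.1 - q.1) ^+ 2 + (p.2 - q.2) ^+ 2)%R.

Definition midpoint (R : realType) (p q : R * R) : R * R :=
  ((p.1 + q.1) / 2, (p.2 + q.2) / 2)%R.

(* Vertex i of a graph on the point list P is placed at pos P i; different
   vertices may have the same position. *)
Definition pos (R : realType) (P : seq (R * R)) (i : nat) : R * R :=
  nth (0, 0)%R P i.

Definition edge_length (R : realType) (P : seq (R * R)) (e : nat * nat) : R :=
  dist (pos P e.1) (pos P e.2).

Definition lmax (R : realType) (P : seq (R * R)) (G : graph 'I_(size P)) : R :=
  \big[Num.max/0%R]_(e : 'I_(size P) * 'I_(size P) | adj G e.1 e.2)
    edge_length P (e.1 : nat, e.2 : nat).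

(* The Steiner points S are appended to X. They are additional vertices, but
   the position of a Steiner point may be that of a point of X. *)
Definition is_MBSN (R : realType) (k : nat) (X S : seq (R * R))
    (N : graph 'I_(size (X ++ S))) : Prop :=
  [/\ size S = k, verts N = setT, two_connected N &
      forall (S' : seq (R * R)) (N' : graph 'I_(size (X ++ S'))),
        size S' = k -> verts N' = setT -> two_connected N' ->
        (lmax N <= lmax N')%R].
Arguments is_MBSN {R} k X S N.

Section TwoRNG.
Context (R : realType) (P : seq (R * R)).

Definition open_lune (i j : 'I_(size P)) : {set 'I_(size P)} :=
  [set k : 'I_(size P) |
     (dist (pos P k) (pos P i) < dist (pos P i) (pos P j))%R &&
     (dist (pos P k) (pos P j) < dist (pos P i) (pos P j))%R].

Definition rng_adj : rel 'I_(size P) :=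
  fun i j => (i != j) && (#|open_lune i j| < 2).

Lemma dist_sym (p q : R * R) : dist p q = dist q p.
Proof. by rewrite /dist -(opprB q.1) -(opprB q.2) !sqrrN. Qed.

Lemma rng_adj_sym : symmetric rng_adj.
Proof.
move=> i j; rewrite /rng_adj eq_sym; congr (_ && (_ < 2)).
by apply: eq_card => k; rewrite !inE (dist_sym (pos P j) (pos P i)) andbC.
Qed.

Lemma rng_adj_irr : irreflexive rng_adj.
Proof. by move=> i; rewrite /rng_adj eqxx. Qed.

Lemma rng_adj_verts (i j : 'I_(size P)) :
  rng_adj i j -> i \in [set: 'I_(size P)].
Proof. by rewrite inE. Qed.

Definition rng2_graph : graph 'I_(size P) :=
  Graph rng_adj_sym rng_adj_irr rng_adj_verts.

End TwoRNG.

(* Coloured points are pairs (point, colour). *)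
Definition colour_spanning (R : realType) (Q : seq ((R * R) * nat))
    (c : R * R) (r : R) : Prop :=
  forall col, col \in map snd Q ->
    exists2 p, (p, col) \in Q & (dist c p <= r)%R.

Definition smallest_colour_spanning (R : realType) (Q : seq ((R * R) * nat))
    (c : R * R) (r : R) : Prop :=
  colour_spanning Q c r /\
  (forall c' r', colour_spanning Q c' r' -> (r <= r')%R).

(* A tree is a pair (blocks, cut-vertices), where a block is given by the list
   of its vertices and is joined in the tree to the cut-vertices it contains.
   There is one tree for every connected component. *)
Definition bctree : Type := (seq (seq nat) * seq nat)%type.
Definition bcforest : Type := seq bctree.

Definition vset (n : nat) (B : seq nat) : {set 'I_n} :=
  [set i : 'I_n | (i : nat) \in B].

Definition lists (T : eqType) (s : seq T) (P : T -> Prop) : Prop :=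
  uniq s /\ (forall x, x \in s <-> P x).

Definition is_bcforest (n : nat) (G : graph 'I_n) (F : bcforest) : Prop :=
  let blocks := flatten (map fst F) in
  let cuts := flatten (map snd F) in
  [/\ all (fun B => uniq B && all (fun i => i < n) B) blocks
        && all (fun i => i < n) cuts,
      lists (map (vset n) blocks)
        (fun A => exists2 H, is_block G H & verts H = A),
      lists cuts (fun i => exists2 v : 'I_n, cut_vertex G v & i = v),
      lists (map (fun T : bctree => vset n (flatten T.1)) F) (component G) &
      forall T : bctree, T \in F -> {subset T.2 <= flatten T.1}].

(* The number is the count of elementary steps on a real RAM: a constant
   number of arithmetic operations, square roots, comparisons and accesses to
   an array counts as one step. *)
Definition cost (A : Type) : Type := (A * nat)%type.

Definition ret (A : Type) (a : A) : cost A := (a, 0).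
Definition bind (A B : Type) (m : cost A) (f : A -> cost B) : cost B :=
  ((f m.1).1, m.2 + (f m.1).2).
Definition tick (k : nat) : cost unit := (tt, k).

Notation "'let!' x := m 'in' k" := (bind m (fun x => k))
  (at level 200, x name, m at level 100, k at level 200).
Notation "m ;; k" := (bind m (fun _ => k))
  (at level 100, k at level 200, right associativity).

(* Single passes over a list; f and p must be constant-time operations. *)
Definition mapC (A B : Type) (f : A -> B) (s : seq A) : cost (seq B) :=
  (map f s, (size s).+1).
Definition filterC (A : Type) (p : pred A) (s : seq A) : cost (seq A) :=
  (filter p s, (size s).+1).
Definition countC (A : Type) (p : pred A) (s : seq A) : cost nat :=
  (count p s, (size s).+1).
Definition concatC (A : Type) (ss : seq (seq A)) : cost (seq A) :=
  (flatten ss, (size ss + size (flatten ss)).+1).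
Definition mergeC (R : realType) (s1 s2 : seq R) : cost (seq R) :=
  (merge (fun x y => x <= y)%R s1 s2, (size s1 + size s2).+1).

Fixpoint traverseC (A B : Type) (f : A -> cost B) (s : seq A) : cost (seq B) :=
  tick 1 ;;
  if s is x :: s' then
    let! y := f x in
    let! ys := traverseC f s' in
    ret (y :: ys)
  else ret [::].

Fixpoint msortC_rec (R : realType) (fuel : nat) (s : seq R) : cost (seq R) :=
  tick (size s).+1 ;;
  if fuel is fuel'.+1 then
    if size s <= 1 then ret s else
    let! s1 := msortC_rec fuel' (take (size s)./2 s) in
    let! s2 := msortC_rec fuel' (drop (size s)./2 s) in
    mergeC s1 s2
  else ret s.

Definition msortC (R : realType) (s : seq R) : cost (seq R) :=
  msortC_rec (size s) s.

(* The last two fields resolve the arbitrary choices of the algorithm: of an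
   edge in a nonempty list, and of a median position in lo, ..., hi-1. *)
Record procedures (R : realType) := Procedures {
  rng2C : seq (R * R) -> cost (seq (nat * nat));
  mbsn0C : seq (R * R) -> seq (nat * nat) -> cost (seq (nat * nat));
  bcforestC : nat -> seq (nat * nat) -> cost bcforest;
  spanningC : seq ((R * R) * nat) -> cost ((R * R) * R);
  pick_edge : seq (nat * nat) -> nat * nat;
  median : nat -> nat -> nat
}.

Definition nlogn (n : nat) : nat := n * (up_log 2 n).+1.

(* The second construction of the algorithm is applied to X together with a
   point that may coincide with one of X, so the procedures are required to
   work on lists in which a position occurs at most twice. *)
Definition at_most_twice (R : realType) (P : seq (R * R)) : Prop :=
  forall p, count_mem p P <= 2.

Record known_procedures (R : realType) (pr : procedures R) : Prop := {
  rng2C_spec : exists c : nat, forall P : seq (R * R),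
    0 < size P -> at_most_twice P ->
    [/\ represents (rng2C pr P).1 (rng2_graph P),
        size (rng2C pr P).1 <= c * size P &
        (rng2C pr P).2 <= c * size P ^ 2];
  mbsn0C_spec : exists c : nat, forall (P : seq (R * R)) (E : seq (nat * nat)),
    0 < size P -> at_most_twice P -> represents E (rng2_graph P) ->
    [/\ edge_list (size P) (mbsn0C pr P E).1,
        is_MBSN 0 P [::] (graph_of _ (mbsn0C pr P E).1) &
        (mbsn0C pr P E).2 <= c * nlogn (size P)];
  bcforestC_spec : exists c : nat, forall (n : nat) (E : seq (nat * nat)),
    0 < n -> edge_list n E ->
    is_bcforest (graph_of n E) (bcforestC pr n E).1 /\
    (bcforestC pr n E).2 <= c * (n + size E);
  spanningC_spec : forall k : nat, exists c : nat,
    forall Q : seq ((R * R) * nat),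
    0 < size Q -> size (undup (map snd Q)) <= k ->
    smallest_colour_spanning Q (spanningC pr Q).1.1 (spanningC pr Q).1.2 /\
    (spanningC pr Q).2 <= c * nlogn (size Q);
  pick_edge_spec : forall E : seq (nat * nat),
    0 < size E -> pick_edge pr E \in E;
  median_spec : forall lo hi : nat,
    lo < hi ->
    median pr lo hi = (lo + hi).-1./2 \/ median pr lo hi = (lo + hi)./2
}.

(* The set of cut-vertices is an array of marks, initialised once for every
   forest in searchC, so that v \in cuts takes constant time. *)
Definition ncutsC (cuts B : seq nat) : cost nat :=
  countC (fun v => v \in cuts) B.

(* Number of leaf blocks plus twice the number of isolated blocks. *)
Definition bC (blocks : seq (seq nat)) (cuts : seq nat) : cost nat :=
  let! ds := traverseC (ncutsC cuts) blocks in
  let! leaves := countC (fun d => d == 1) ds in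
  let! isolated := countC (fun d => d == 0) ds in
  ret (leaves + 2 * isolated).

(* The interior vertices of the leaf blocks; the colour of a leaf block is its
   rank in the list of blocks. *)
Definition leaf_pointsC (R : realType) (X : seq (R * R))
    (blocks : seq (seq nat)) (cuts : seq nat) : cost (seq ((R * R) * nat)) :=
  let! Qs := traverseC (fun k =>
      let B := nth [::] blocks k in
      let! d := ncutsC cuts B in
      if d == 1 then
        let! I := filterC (fun v => v \notin cuts) B in
        mapC (fun v => (pos X v, k)) I
      else ret [::])
    (iota 0 (size blocks)) in
  concatC Qs.

(* The centre and the radius of C(G) for a connected graph G on X with edge
   list E; G is itself a block if and only if it has a single block. *)
Definition diskC (R : realType) (pr : procedures R) (X : seq (R * R))
    (E : seq (nat * nat)) (blocks : seq (seq nat)) (cuts : seq nat)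
    : cost ((R * R) * R) :=
  if size blocks == 1 then
    tick 1 ;;
    let e := pick_edge pr E in
    ret (midpoint (pos X e.1) (pos X e.2), edge_length X e / 2)%R
  else
    let! Q := leaf_pointsC X blocks cuts in
    spanningC pr Q.

(* A candidate (max(r(G_t), t), t, centre of C(G_t)) found so far. *)
Definition candidate (R : realType) : Type := (R * R * (R * R))%type.

Definition better (R : realType) (new : candidate R)
    (old : option (candidate R)) : option (candidate R) :=
  if old is Some c then (if (new.1.1 < c.1.1)%R then Some new else Some c)
  else Some new.

(* Binary search on the entries lo, ..., hi-1 of L. *)
Fixpoint searchC (R : realType) (pr : procedures R) (X : seq (R * R))
    (E : seq (nat * nat)) (L : seq R) (fuel lo hi : nat)
    (best : option (candidate R)) : cost (option (candidate R)) :=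
  tick 1 ;;
  if fuel is fuel'.+1 then
    if hi <= lo then ret best else
    let m := median pr lo hi in
    let t := nth 0%R L m in
    let! Et := filterC (fun e => edge_length X e <= t)%R E in
    let! F := bcforestC pr (size X) Et in
    let! blocks := concatC (map fst F) in
    let! cuts := concatC (map snd F) in
    tick (size X).+1 ;;
    let! b := bC blocks cuts in
    if (5 < b) || (size F != 1) then
      searchC pr X E L fuel' m.+1 hi best
    else
      let! C := diskC pr X Et blocks cuts in
      let best' := better (Num.max C.2 t, t, C.1) best in
      if (C.2 <= t)%R then searchC pr X E L fuel' lo m best'
      else searchC pr X E L fuel' m.+1 hi best'
  else ret best.

(* Returns the Steiner point and the edge list of the network; in this list
   the Steiner point is the vertex of index size X. *)
Definition algorithm1 (R : realType) (pr : procedures R) (X : seq (R * R))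
    : cost ((R * R) * seq (nat * nat)) :=
  let! E := rng2C pr X in
  let! lengths := mapC (edge_length X) E in
  let! L := msortC lengths in
  let! best := searchC pr X E L (size L).+1 0 (size L) None in
  let s := if best is Some c then c.2 else (0, 0)%R in
  tick (size X).+1 ;;
  let Y := X ++ [:: s] in
  let! EY := rng2C pr Y in
  let! N := mbsn0C pr Y EY in
  ret (s, N).

(* Main.v *)
(* Removing the Steiner point s' of a 2-connected network with bottleneck tau
   leaves a connected graph whose edges have length at most tau. In the 2-RNG
   truncated at any t >= tau, two points at distance at most t stay connected
   after the deletion of any third vertex. Hence this truncation R(t) is
   connected and s' has a network neighbour in the interior of each of its leaf
   blocks; these neighbours are pairwise at distance more than t and within tau
   of s', so there are at most five leaf blocks and r(R(t)) <= max(tau, t).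
   Consequently a step of the binary search that moves away from the last
   length at most tau has found a candidate of value at most tau.
   Conversely, if R(t) has at most five leaf blocks and s is the centre of its
   colour-spanning disk, joining all points of X and s at distance at most
   max(r, t) gives a 2-connected graph: every component of R(t) minus a
   cut-vertex contains the interior of a leaf block.

   The vertex sets of blocks are handled as the maximal cliques of the relation
   "joined, and separated by no single vertex". Two of them share at most one
   vertex, which bounds the total size of the blocks by n + 2|E|. *)
Require Import Defs.
From HB Require Import structures.
From mathcomp Require Import all_boot all_order all_algebra.
From mathcomp Require Import reals.
From mathcomp Require Import zify ring lra.

Set Implicit Arguments.
Unset Strict Implicit.
Unset Printing Implicit Defensive.

Import Order.TTheory GRing.Theory Num.Theory.

(** * Blocks and separation *)

Lemma connect_ind_closed (T : finType) (e : rel T) (P : T -> Prop) x y :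
  (forall a b, e a b -> P a -> P b) -> connect e x y -> P x -> P y.
Proof.
move=> eP /connectP[p]; elim: p x => [|z p IHp] x /=; first by move=> _ ->.
by case/andP=> exz zp yl Px; apply: (IHp z) => //; apply: eP exz Px.
Qed.

Lemma connect_homo (T T' : finType) (e : rel T) (e' : rel T') (f : T -> T') x y :
  (forall a b, e a b -> connect e' (f a) (f b)) ->
  connect e x y -> connect e' (f x) (f y).
Proof.
move=> ee' xy; apply: (connect_ind_closed (P := fun a => connect e' (f x) (f a))) xy _ => //.
by move=> a b /ee' ab xa; apply: connect_trans xa ab.
Qed.

Lemma lists_size1 (T : eqType) (s : seq T) (P : T -> Prop) a :
  lists s P -> P a -> (forall b, P b -> b = a) -> size s = 1.
Proof.
case=> s_uniq sP Pa P1; have sa : a \in s by apply/sP.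
apply/eqP; rewrite eqn_leq; apply/andP; split; last by case: s sa {s_uniq sP}.
by apply: (uniq_leq_size (s2 := [:: a])) => // b /sP /P1 ->; rewrite inE.
Qed.

Section Blocks.
Context (V : finType) (G : graph V).
Hypothesis GT : verts G = [set: V].

Local Notation "G \- z" := (del G [set z]) (at level 50, left associativity).

Lemma del1E z u v :
  adj (G \- z) u v = [&& adj G u v, u != z & v != z].
Proof. by rewrite /= /del_adj !inE. Qed.

Lemma connect_sym_adj (H : graph V) : connect_sym (adj H).
Proof. exact/sym_connect_sym/adj_sym. Qed.

Lemma connect_del S x y : connect (adj (del G S)) x y -> connect (adj G) x y.
Proof. by apply: connect_sub => a b /and3P[ab _ _]; apply: connect1. Qed.

Lemma connect_del_notin S x y :
  connect (adj (del G S)) x y -> x \notin S -> y \notin S.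
Proof. by apply: (connect_ind_closed (P := fun a => a \notin S)) => a b /and3P[]. Qed.

Definition insep x y :=
  connect (adj G) x y &&
  [forall z, (z != x) && (z != y) ==> connect (adj (G \- z)) x y].

Lemma insepP x y :
  reflect (connect (adj G) x y /\
           forall z, z != x -> z != y -> connect (adj (G \- z)) x y)
          (insep x y).
Proof.
apply: (iffP andP) => -[xy xyz]; split=> //.
  by move=> z zx zy; have /forallP/(_ z) := xyz; rewrite zx zy.
by apply/forallP=> z; apply/implyP=> /andP[]; apply: xyz.
Qed.

Lemma insep_refl x : insep x x.
Proof. by apply/insepP; split. Qed.

Lemma insep_sym x y : insep x y = insep y x.
Proof.
by apply/insepP/insepP => -[xy sep]; split=> [|z zx zy];
  rewrite connect_sym_adj //; apply: sep.
Qed.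

Lemma insep_adj x y : adj G x y -> insep x y.
Proof.
move=> xy; apply/insepP; split=> [|z zx zy]; first exact: connect1.
by apply: connect1; rewrite del1E xy eq_sym zx eq_sym zy.
Qed.

Definition mclique (A : {set V}) : Prop :=
  [/\ A != set0, {in A &, forall x y, insep x y} &
      forall p, {in A, forall a, insep p a} -> p \in A].

Lemma mclique_extend (A : {set V}) :
  A != set0 -> {in A &, forall x y, insep x y} ->
  exists2 B, mclique B & A \subset B.
Proof.
move=> A0 Acl.
pose cl (B : {set V}) := [forall x in B, forall y in B, insep x y].
have clP (B : {set V}) : reflect {in B &, forall x y, insep x y} (cl B).
  apply: (iffP 'forall_in_'forall_in_idP) => // H x y xB yB; exact: H.
have [B /maxsetP[/clP Bcl Bmax] AB] : {B | maxset cl B & A \subset B}.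
  by apply: maxset_exists; apply/clP.
exists B => //; split=> //.
  by have [x xA] := set0Pn _ A0; apply/set0Pn; exists x; apply: subsetP xA.
move=> p pB; rewrite -(Bmax (p |: B)) ?setU11 ?subsetUr //.
apply/clP=> x y /setU1P[->|xB] /setU1P[->|yB]; first exact: insep_refl.
- exact: pB.
- by rewrite insep_sym; apply: pB.
- exact: Bcl.
Qed.

Lemma mclique_mem x : exists2 A, mclique A & x \in A.
Proof.
have [|y z /set1P-> /set1P->|A clA] := @mclique_extend [set x].
- by apply/set0Pn; exists x; rewrite inE.
- exact: insep_refl.
- by rewrite sub1set => xA; exists A.
Qed.

(** A member of one clique reaches a member of the other through [x] as well as through [y], and a
    single deleted vertex blocks at most one of these routes. *)
Lemma mclique_eq A B x y :
  mclique A -> mclique B -> x != y ->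
  x \in A -> y \in A -> x \in B -> y \in B -> A = B.
Proof.
suff sub A' B' : mclique A' -> mclique B' -> x != y ->
    x \in A' -> y \in A' -> x \in B' -> y \in B' -> A' \subset B'.
  by move=> *; apply/eqP; rewrite eqEsubset !sub.
move=> [_ clA _] [_ clB maxB] xy xA yA xB yB; apply/subsetP=> a aA.
apply: maxB => b bB; apply/insepP.
have via w : w \in A' -> w \in B' ->
    forall z, z != a -> z != b -> z != w -> connect (adj (G \- z)) a b.
  move=> wA wB z za zb zw.
  have /insepP[_ /(_ z za zw) aw] := clA _ _ aA wA.
  have /insepP[_ /(_ z zw zb) wb] := clB _ _ wB bB.
  exact: connect_trans aw wb.
split=> [|z za zb].
  have /insepP[ax _] := clA _ _ aA xA; have /insepP[xb _] := clB _ _ xB bB.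
  exact: connect_trans ax xb.
have [zx|zx] := eqVneq z x; last exact: via zx.
by apply: (via y) => //; rewrite zx.
Qed.

(** If [p] reached [b] without [a], it would be inseparable from all of [A]: the edge to [a] serves
    when another vertex is deleted, the detour through [b] when [a] itself is. Maximality would then
    put [p] into [A]. *)
Lemma mclique_exit A a p b :
  mclique A -> a \in A -> p \notin A -> adj G a p -> b \in A -> b != a ->
  ~~ connect (adj (G \- a)) p b.
Proof.
case=> _ clA maxA aA pA ap bA ba; apply: contra pA => pb; apply: maxA => b' b'A.
have /insepP[ab' sep] := clA _ _ aA b'A.
apply/insepP; split=> [|z zp zb'].
  by apply: connect_trans ab'; apply: connect1; rewrite adj_sym.
have [zE|za] := eqVneq z a; last first.
  apply: connect_trans (sep z za zb'); apply: connect1.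
  by rewrite del1E adj_sym ap eq_sym zp eq_sym za.
have /insepP[_ sepb] := clA _ _ bA b'A.
by move: zb'; rewrite zE => ?; apply: connect_trans pb (sepb _ _ _); rewrite // eq_sym.
Qed.

(** * Maximal cliques induce exactly the blocks *)

Section Induced.
Context (A : {set V}).

Definition induced_adj : rel V := fun u v => [&& adj G u v, u \in A & v \in A].

Lemma induced_adj_sym : symmetric induced_adj.
Proof. by move=> u v; rewrite /induced_adj adj_sym [(u \in A) && _]andbC. Qed.

Lemma induced_adj_irr : irreflexive induced_adj.
Proof. by move=> u; rewrite /induced_adj adj_irr. Qed.

Lemma induced_adj_verts u v : induced_adj u v -> u \in A.
Proof. by case/and3P. Qed.

Definition induced : graph V :=
  Graph induced_adj_sym induced_adj_irr induced_adj_verts.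

End Induced.

(** A repetition-free path between two members cannot leave the clique: its tail would return
    without passing the exit vertex again. *)
Lemma mclique_connect_induced A S x y :
  mclique A -> x \in A -> y \in A -> connect (adj (del G S)) x y ->
  connect (adj (del (induced A) S)) x y.
Proof.
move=> clA xA yA /connectP[p0 p0P yE]; move: yE yA.
case/shortenP: p0P => p pP p_uniq _ -> {p0 y}.
elim: p x xA pP p_uniq => [|w p IHp] x xA //=.
case/andP=> xw wp /and3P[xwp wp' p_uniq] lA.
have /and3P[xw' xS wS] := xw.
have wA : w \in A.
  have [//|wA] := boolP (w \in A).
  have lx : last w p != x by apply: contraNneq xwp => <-; apply: mem_last.
  case/negP: (mclique_exit clA xA wA xw' lA lx).
  apply/connectP; exists p => //.
  have : path (adj (del G S)) w p := wp.
  elim: p w xwp {wp' p_uniq lA lx xw xw' wS wA IHp wp} => //= a p IHp w.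
  rewrite !inE !negb_or => /and3P[xw xa xp] /andP[wa ap].
  case/and3P: wa => wa _ _.
  rewrite IHp ?inE ?negb_or ?xa // andbT; apply/and3P.
  by rewrite !inE wa eq_sym xw eq_sym xa.
apply: connect_trans (IHp w wA wp _ lA); last by rewrite /= wp'.
by apply: connect1; apply/and3P; split=> //; apply/and3P.
Qed.

Lemma card_le1_set (S : {set V}) : #|S| < 2 -> S = set0 \/ exists z, S = [set z].
Proof.
case: (posnP #|S|) => [/cards0_eq->|S0 S2]; first by left.
by right; apply/cards1P; rewrite eqn_leq S0 -ltnS S2.
Qed.

Lemma connect_del0 (H : graph V) x y :
  connect (adj (del H set0)) x y = connect (adj H) x y.
Proof. by apply: eq_connect => a b; rewrite /= /del_adj !inE !andbT. Qed.

Lemma two_connected_induced A : mclique A -> two_connected (induced A).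
Proof.
move=> clA; have [A0 Acl _] := clA.
have conn (S : {set V}) x y : #|S| < 2 -> x \in A :\: S -> y \in A :\: S ->
    connect (adj (del (induced A) S)) x y.
  move=> /card_le1_set S1 /setDP[xA xS] /setDP[yA yS].
  apply: mclique_connect_induced => //; have /insepP[xy sep] := Acl _ _ xA yA.
  case: S1 xS yS => [->|[z ->]]; first by rewrite connect_del0.
  by rewrite !inE => xz yz; apply: sep; rewrite eq_sym.
have [A3|A3] := ltnP 2 #|A|; [left | right].
  split=> // S SA S2; apply/andP; split.
    rewrite -card_gt0 cardsD subn_gt0 (leq_ltn_trans _ (ltn_trans S2 A3)) //.
    by rewrite subset_leq_card ?subsetIr.
  apply/forall_inP => x xAS; apply/forall_inP => y yAS; exact: conn.
split; last first.
  by move: A3; rewrite -card_gt0 in A0; case: #|A| A0 => [|[|[|]]] //; auto.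
move=> x y xA yA xy.
have := conn set0 x y; rewrite cards0 !setD0 => /(_ isT xA yA).
rewrite connect_del0 => /connectP[p0 p0P yE]; move: yE xy.
case/shortenP: p0P => -[|w p] /=; first by move=> _ _ _ ->; rewrite eqxx.
case/andP=> xw wp /and3P[xwp wp' p_uniq] _ yE _.
have /and3P[_ _ wA] := xw.
(* A first step to some [w] other than [y] would give three distinct members of [A], which has at
   most two. *)
suff -> : y = w by [].
apply/eqP; apply: contraTT A3 => yw; rewrite -ltnNge.
have wx : w != x by apply: contraNneq xwp => <-; rewrite inE eqxx.
have yx : y != x by apply: contraNneq xwp => <-; rewrite yE mem_last.
apply: leq_trans (subset_leq_card (_ : x |: [set y; w] \subset A)).
  by rewrite cardsU1 cards2 !inE negb_or [x == y]eq_sym yx [x == w]eq_sym wx yw.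
by apply/subsetP=> a; rewrite !inE => /or3P[] /eqP->.
Qed.

Lemma two_connected_insep H :
  subgraph H G -> two_connected H -> {in verts H &, forall x y, insep x y}.
Proof.
move=> [_ HG] tcH x y xH yH; case: tcH => [[_ conn]|[compl _]]; last first.
  by have [->|xy] := eqVneq x y; [exact: insep_refl | apply/insep_adj/HG/compl].
apply/insepP; split=> [|z zx zy].
  have := conn set0; rewrite sub0set cards0 => /(_ isT isT) /andP[_].
  move=> /forall_inP/(_ x); rewrite !inE xH => /(_ isT) /forall_inP/(_ y).
  rewrite !inE yH connect_del0 => /(_ isT); apply: connect_sub => a b ab.
  exact/connect1/HG.
(* [z] may lie outside [H], where only subsets of [verts H] may be deleted. *)
have := conn ([set z] :&: verts H); rewrite subsetIr => /(_ isT).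
rewrite ltnS (leq_trans (subset_leq_card (subsetIl _ _))) ?cards1 //.
move=> /(_ isT) /andP[_] /forall_inP/(_ x).
rewrite !inE xH !andbT [x == z]eq_sym zx => /(_ isT) /forall_inP/(_ y).
rewrite !inE yH !andbT [y == z]eq_sym zy => /(_ isT).
apply: connect_sub => a b /and3P[ab aS bS]; apply: connect1; rewrite del1E HG //=.
have aH := adj_verts ab; have bH : b \in verts H by rewrite adj_sym in ab; exact: adj_verts ab.
by move: aS bS; rewrite !inE aH bH !andbT => -> ->.
Qed.

Lemma two_connected_neq0 (H : graph V) : two_connected H -> verts H != set0.
Proof.
case=> [[H2 _]|[_ H12]]; rewrite -card_gt0; first exact: ltn_trans H2.
by case: H12 => ->.
Qed.

Lemma induced_subgraph A : subgraph (induced A) G.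
Proof. by split; [rewrite GT subsetT | move=> u v /and3P[]]. Qed.

Lemma blockP A : (exists2 H, is_block G H & verts H = A) <-> mclique A.
Proof.
split=> [[H [HG tcH maxH] <-]|clA].
  have Hcl := two_connected_insep HG tcH.
  split=> //; first exact: two_connected_neq0.
  move=> p pH; have [||B clB BH] := @mclique_extend (p |: verts H).
  - by apply/set0Pn; exists p; rewrite setU11.
  - move=> x y /setU1P[->|xB] /setU1P[->|yB]; first exact: insep_refl.
    + exact: pH.
    + by rewrite insep_sym; apply: pH.
    + exact: Hcl.
  have [|BH' _] := maxH (induced B) (induced_subgraph _) (two_connected_induced clB).
    split=> [|u v uv]; first exact: subset_trans (subsetUr _ _) BH.
    have uH := adj_verts uv; have vH : v \in verts H by rewrite adj_sym in uv; exact: adj_verts uv.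
    case: HG => _ HG; apply/and3P; split; [exact: HG| |];
      by apply: (subsetP BH); rewrite !inE ?uH ?vH orbT.
  by apply: (subsetP BH'); apply: (subsetP BH); rewrite setU11.
exists (induced A) => //; split; first exact: induced_subgraph.
  exact: two_connected_induced.
move=> H' H'G tcH' [AH' _]; have cl' := two_connected_insep H'G tcH'.
have H'A : verts H' \subset A.
  apply/subsetP=> p pH'; case: clA => _ _; apply=> a aA.
  by apply: cl' => //; apply: (subsetP AH').
split=> // u v uv; case: H'G => _ H'G.
have uH := adj_verts uv; have vH : v \in verts H' by rewrite adj_sym in uv; exact: adj_verts uv.
by apply/and3P; split; [exact: H'G| |]; apply: (subsetP H'A).
Qed.

Definition cutb v :=
  [exists u, exists w, [&& u != v, w != v, connect (adj G) u w &
                           ~~ connect (adj (G \- v)) u w]].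

Lemma cutP v : reflect (cut_vertex G v) (cutb v).
Proof.
apply: (iffP 'exists_existsP) => [[u [w /and4P[uv wv uw uwv]]]|].
  by split; rewrite GT ?inE //; exists u, w; split; rewrite ?GT ?inE ?uw.
case=> _ [u [w [uv wv _ _ /andP[uw uwv]]]].
by exists u, w; rewrite uv wv uw uwv.
Qed.

Lemma kconnected2P :
  2 < #|V| ->
  (kconnected 2 G <->
   forall z u w, u != z -> w != z -> connect (adj (G \- z)) u w).
Proof.
move=> V3; split=> [[_ conn] z u w uz wz|conn].
  have := conn [set z]; rewrite GT subsetT cards1 => /(_ isT isT) /andP[_].
  move=> /forall_inP/(_ u); rewrite !inE uz GT inE => /(_ isT).
  by move=> /forall_inP/(_ w); rewrite !inE wz GT inE => /(_ isT).
split; first by rewrite GT cardsT.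
move=> S _ S2; apply/andP; split.
  rewrite /= GT setTD -card_gt0 cardsCs setCK subn_gt0.
  exact: ltn_trans S2 V3.
apply/forall_inP=> u; rewrite /= GT setTD inE => uS.
apply/forall_inP=> w; rewrite inE => wS.
have [S0|[z Sz]] := card_le1_set S2; last first.
  by move: uS wS; rewrite Sz !inE => uz wz; apply: conn.
rewrite S0 connect_del0.
(* When nothing is deleted, a third vertex [z] is sacrificed: [u] and [w] are joined even without
   it. *)
have [z] : exists z, z \in ~: [set u; w].
  apply/set0Pn; rewrite -card_gt0 cardsCs setCK subn_gt0.
  by apply: leq_ltn_trans V3; rewrite cards2; case: (_ != _).
by rewrite !inE negb_or ![z == _]eq_sym => /andP[uz wz]; apply: connect_del (conn z _ _ uz wz).
Qed.

Lemma mclique_neighbour A x y :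
  mclique A -> x \in A -> y \in A -> x != y -> exists2 w, w \in A & adj G x w.
Proof.
move=> clA xA yA xy; have [_ Acl _] := clA.
have /insepP[] := Acl _ _ xA yA; rewrite -connect_del0 => con _.
have := mclique_connect_induced clA xA yA con.
case/connectP=> -[|w p] /=; first by move=> _ yx; rewrite yx eqxx in xy.
by case/andP=> /and3P[/and3P[xw _ wA] _ _] _ _; exists w.
Qed.

(** Double counting. At a vertex [x], each clique containing [x] is sent to a neighbour of [x] in
    it, or to [None] if there is none. This is injective, since two cliques share at most one vertex
    and only [[set x]] gives [None]; so at most [1 + deg x] cliques contain [x]. *)
Lemma sum_card_mclique (s : seq {set V}) :
  uniq s -> {in s, forall A, mclique A} ->
  \sum_(A <- s) #|A| <= #|V| + \sum_(x : V) #|[set y | adj G x y]|.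
Proof.
move=> s_uniq clS.
have -> : \sum_(A <- s) #|A| = \sum_(x : V) count (fun A : {set V} => x \in A) s.
  under eq_bigr => A _ do rewrite -sum1_card big_mkcond.
  rewrite exchange_big /=; apply: eq_bigr => x _.
  by rewrite -sum1_count [RHS]big_mkcond.
rewrite -sum1_card -big_split /=; apply: leq_sum => x _.
pose f (A : {set V}) := [pick y | (y \in A) && adj G x y].
have f_None A : mclique A -> x \in A -> f A = None -> A = [set x].
  move=> clA xA; rewrite /f; case: pickP => // noy _.
  apply/eqP; rewrite eqEsubset sub1set xA andbT; apply/subsetP=> y yA; rewrite inE.
  apply: contraT; rewrite eq_sym => /(mclique_neighbour clA xA yA)[w wA xw].
  by have := noy w; rewrite wA xw.
have -> : 1 + #|[set y | adj G x y]| =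
    size (None :: [seq Some i | i <- enum [set y | adj G x y]]).
  by rewrite /= size_map -cardE.
rewrite -size_filter -(size_map f); apply: uniq_leq_size.
  rewrite map_inj_in_uniq ?filter_uniq // => A B.
  rewrite !mem_filter => /andP[xA /clS clA] /andP[xB /clS clB] fAB.
  case fA: (f A) => [y|]; last by rewrite (f_None A) // (f_None B) // -fAB.
  have fB : f B = Some y by rewrite -fAB.
  move: fA fB; rewrite /f; case: pickP => // y1 /andP[yA xy] [<-].
  case: pickP => // y2 /andP[yB _] [y21]; rewrite y21 in yB.
  apply: mclique_eq clA clB _ xA yA xB yB; apply: contraTneq xy => ->.
  by rewrite adj_irr.
move=> _ /mapP[A _ ->]; rewrite /f; case: pickP => [y /andP[_ xy]|_].
  by rewrite inE /=; apply: map_f; rewrite mem_enum inE.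
by rewrite inE eqxx.
Qed.

(** * Cut-vertices and leaf blocks of a connected graph *)

Section Connected.
Hypothesis Gconn : forall x y, connect (adj G) x y.

Lemma noncut_connect v u w :
  ~~ cutb v -> u != v -> w != v -> connect (adj (G \- v)) u w.
Proof.
move=> + uv wv; apply: contraNT => uw.
by apply/existsP; exists u; apply/existsP; exists w; rewrite uv wv Gconn.
Qed.

(** Only the deletion of [u] could break the route through [u], and deleting a non-cut-vertex keeps
    all other vertices joined. *)
Lemma noncut_insep_trans u x y :
  ~~ cutb u -> insep x u -> insep u y -> insep x y.
Proof.
move=> cu /insepP[_ xu] /insepP[_ uy]; apply/insepP; split=> // z zx zy.
have [zu|zu] := eqVneq z u; last exact: connect_trans (xu z zx zu) (uy z zu zy).
by apply: noncut_connect; rewrite ?zu // -zu eq_sym.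
Qed.

Lemma noncut_mclique u : ~~ cutb u -> mclique [set x | insep x u].
Proof.
move=> cu; split.
- by apply/set0Pn; exists u; rewrite inE insep_refl.
- move=> x y; rewrite !inE => xu yu; apply: noncut_insep_trans cu xu _.
  by rewrite insep_sym.
- by move=> p /(_ u); rewrite !inE; apply; apply: insep_refl.
Qed.

Lemma mclique_noncut u A :
  ~~ cutb u -> mclique A -> u \in A -> A = [set x | insep x u].
Proof.
move=> cu [_ clA maxA] uA; apply/setP=> x; rewrite inE.
apply/idP/idP => [xA|xu]; first exact: clA.
by apply: maxA => a aA; apply: noncut_insep_trans cu xu (clA _ _ uA aA).
Qed.

Definition leaf (A : {set V}) c :=
  [/\ mclique A, c \in A, cutb c & {in A, forall x, cutb x -> x = c}].

Lemma leaf_noncut A c x : leaf A c -> x \in A -> x != c -> ~~ cutb x.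
Proof. by case=> _ _ _ A1 xA; apply: contra => /(A1 x xA) ->. Qed.

(** An interior vertex of a leaf block lies in no other block, and adjacent vertices are
    inseparable, so [c] is the only way out. *)
Lemma leaf_closed A c x y :
  leaf A c -> connect (adj (G \- c)) x y -> x \in A :\ c -> y \in A :\ c.
Proof.
move=> lA; apply: (connect_ind_closed (P := fun y => y \in A :\ c)) => {x y} x y.
rewrite del1E !inE => /and3P[xy xc yc] /andP[_ xA]; rewrite yc.
have cx := leaf_noncut lA xA xc; case: lA => clA _ _ _.
by rewrite (mclique_noncut cx clA xA) inE insep_sym insep_adj.
Qed.

(** Up to its first arrival at [x], a walk from [z] to [x] stays in the component of [z] in [G - x],
    which does not contain [v]. *)
Lemma separated_connect x v z :
  x != v -> z != x -> ~~ connect (adj (G \- x)) v z ->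
  connect (adj (G \- v)) z x.
Proof.
move=> xv zx vz.
have lift a : connect (adj (G \- x)) z a ->
    connect (adj (G \- v)) z a && (a != v).
  move=> za; have : connect (adj (G \- x)) z a /\ connect (adj (G \- v)) z a /\ a != v.
    pose P a := connect (adj (G \- x)) z a /\ connect (adj (G \- v)) z a /\ a != v.
    apply: (connect_ind_closed (P := P)) za _ => [b b' bb' [zb [zb' bv]]|].
      have zb2 := connect_trans zb (connect1 bb').
      have b'v : b' != v.
        by apply: contra vz => /eqP <-; rewrite connect_sym_adj.
      split=> //; split=> //; apply: connect_trans zb' (connect1 _).
      by rewrite del1E bv b'v; case/and3P: bb' => ->.
    by split=> //; split=> //; apply: contra vz => /eqP->.
  by case=> _ [-> ->].
pose P a := connect (adj (G \- x)) z a \/ connect (adj (G \- v)) z x.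
have : P x.
  apply: (connect_ind_closed (P := P)) (Gconn z x) _ => [a b ab [za|]|].
  - have [bx|bx] := eqVneq b x.
      have /andP[za' av] := lift _ za; right.
      by apply: connect_trans za' (connect1 _); rewrite del1E -bx ab av bx.
    left; apply: (connect_trans za); apply: connect1; rewrite del1E ab bx andbT /=.
    by have := connect_del_notin za; rewrite !inE => ->.
  - by right.
  - by left.
case=> // /connect_del_notin; rewrite !inE zx => /(_ isT).
by rewrite eqxx.
Qed.

(** Induction on the size of the component [K] of [w] in [G - v]. If [K] contains a cut-vertex [x],
    some component of [G - x] avoids [v] and lies strictly inside [K]; otherwise the block of [w] is
    a leaf block with cut-vertex [v]. *)
Lemma leaf_exists v w :
  cutb v -> w != v ->
  exists A c u, [/\ leaf A c, u \in A :\ c &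
    {in A :\ c, forall x, connect (adj (G \- v)) w x}].
Proof.
move: {2}_.+1 (ltnSn #|[set x | connect (adj (G \- v)) w x]|) => m.
elim: m v w => // m IHm v w Km cv wv.
have [x /andP[wx cx]|noncut] :=
  pickP (fun x => connect (adj (G \- v)) w x && cutb x).
  have xv : x != v by have := connect_del_notin wx; rewrite !inE => ->.
  have [y yx vy] : exists2 y, y != x & ~~ connect (adj (G \- x)) v y.
    have /existsP[y1 /existsP[y2 /and4P[y1x y2x _ y12]]] := cx.
    have [vy1|] := boolP (connect (adj (G \- x)) v y1); last by exists y1.
    exists y2 => //; apply: contra y12 => vy2.
    by apply: connect_trans vy2; rewrite connect_sym_adj.
  have sub z : connect (adj (G \- x)) y z -> connect (adj (G \- v)) w z.
    move=> yz; apply: connect_trans wx _; rewrite connect_sym_adj.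
    apply: separated_connect => //.
      by have := connect_del_notin yz; rewrite !inE => ->.
    apply: contra vy => vz; apply: connect_trans vz _.
    by rewrite connect_sym_adj.
  have [|A [c [u [lA uA AK]]]] := IHm x y _ cx yx.
    rewrite -ltnS; apply: leq_trans Km; rewrite ltnS; apply: proper_card.
    apply/properP; split; first by apply/subsetP=> z; rewrite !inE => /sub.
    exists x; rewrite !inE //; apply: contraL yx => /connect_del_notin.
    by rewrite !inE eqxx => yx; apply/negP=> /yx.
  by exists A, c, u; split=> // z /AK /sub.
have cw : ~~ cutb w by have := noncut w; rewrite connect0 /= => ->.
have inK x : insep x w -> x != v -> connect (adj (G \- v)) w x.
  by move=> /insepP[_ sep] xv; rewrite connect_sym_adj; apply: sep; rewrite eq_sym.
exists [set x | insep x w], v, w; split.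
- split=> //; first exact: noncut_mclique.
    (* [v] belongs to the block of [w]: a vertex [z] separating them would be reachable from [w]
       without [v], hence not be a cut-vertex. *)
    rewrite inE; apply/insepP; split=> // z zv zw.
    apply: contraT => vw; have := noncut z.
    rewrite (separated_connect zv _ vw) 1?eq_sym //= => /negbT cz.
    by case/negP: vw; apply: noncut_connect; rewrite // eq_sym.
  move=> x; rewrite inE => xw cx; apply: contraTeq cx => xv.
  by have := noncut x; rewrite inK //= => ->.
- by rewrite !inE wv insep_refl.
- by move=> x; rewrite !inE => /andP[xv xw]; apply: inK.
Qed.

Lemma noncut_mclique_setT A : (forall v, ~~ cutb v) -> mclique A -> A = setT.
Proof.
move=> nocut clA; have [/set0Pn[u uA] _ _] := clA.
rewrite (mclique_noncut (nocut u) clA uA); apply/setP=> x; rewrite !inE.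
apply/insepP; split=> // z zx zu; apply: noncut_connect; rewrite 1?eq_sym //.
Qed.

End Connected.

End Blocks.

(** * Points in a disk *)

Section Distance.
Context (R : realType).
Local Open Scope ring_scope.
Implicit Types p q c : R * R.

Definition sqdist p q : R := (p.1 - q.1) ^+ 2 + (p.2 - q.2) ^+ 2.

Lemma sqdist_ge0 p q : 0 <= sqdist p q.
Proof. by rewrite addr_ge0 ?sqr_ge0. Qed.

Lemma dist_ge0 p q : 0 <= dist p q.
Proof. exact: sqrtr_ge0. Qed.

Lemma sqr_dist p q : dist p q ^+ 2 = sqdist p q.
Proof. by rewrite sqr_sqrtr // sqdist_ge0. Qed.

Lemma dist_le p q r : 0 <= r -> (dist p q <= r) = (sqdist p q <= r ^+ 2).
Proof. by move=> r0; rewrite -sqr_dist ler_sqr ?nnegrE ?dist_ge0. Qed.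

Lemma dist_midpoint p q : dist (midpoint p q) p = dist p q / 2.
Proof.
apply/eqP; rewrite -(@eqrXn2 _ 2) ?dist_ge0 ?divr_ge0 ?dist_ge0 //.
by rewrite exprMn !sqr_dist /sqdist /midpoint /=; apply/eqP; field.
Qed.

Lemma midpointC p q : midpoint p q = midpoint q p.
Proof. by rewrite /midpoint addrC [p.2 + _]addrC. Qed.

(** The squared length in coordinates along two unit vectors at 60 degrees. *)
Definition hexnorm (x y : R) : R := x ^+ 2 + x * y + y ^+ 2.

(** The six sectors of 60 degrees cut out by the lines [x = 0], [y = 0] and [x + y = 0], numbered
    counterclockwise. *)
Definition hexsector (x y : R) : nat :=
  if 0 <= y then if 0 <= x then 0%N else if 0 <= x + y then 1%N else 2%N
  else if x <= 0 then 3%N else if x + y <= 0 then 4%N else 5%N.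

(** A difference whose coordinates have the same sign is dominated by one of the two points, up to
    sign. With opposite signs the mixed term is at most 0 and the form is at most the square of the
    larger coordinate. *)
Lemma hexnorm_quadrant (a b a' b' T : R) :
  0 <= a -> 0 <= b -> 0 <= a' -> 0 <= b' ->
  hexnorm a b <= T -> hexnorm a' b' <= T -> hexnorm (a - a') (b - b') <= T.
Proof.
move=> a0 b0 a'0 b'0 nT n'T.
have mono (u v c d : R) : 0 <= u <= c -> 0 <= v <= d -> hexnorm u v <= hexnorm c d.
  move=> /andP[u0 uc] /andP[v0 vd]; rewrite /hexnorm.
  by rewrite !lerD ?ler_pM // ler_sqr ?nnegrE //; lra.
have anti (u v c d e f : R) : 0 <= u <= c -> 0 <= v <= f -> 0 <= d -> 0 <= e ->
    hexnorm c d <= T -> hexnorm e f <= T -> hexnorm u (- v) <= T.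
  move=> /andP[u0 uc] /andP[v0 vf] d0 e0.
  have cd0 : 0 <= c * d by rewrite mulr_ge0 // (le_trans u0).
  have ef0 : 0 <= e * f by rewrite mulr_ge0 // (le_trans v0).
  have uc2 : u ^+ 2 <= c ^+ 2 by rewrite ler_sqr ?nnegrE //; lra.
  have vf2 : v ^+ 2 <= f ^+ 2 by rewrite ler_sqr ?nnegrE //; lra.
  rewrite /hexnorm; have [uv|uv] := leP u v.
    by have := mulr_ge0 u0 (_ : 0 <= v - u); rewrite subr_ge0 => /(_ uv); nra.
  by have := mulr_ge0 v0 (_ : 0 <= u - v); rewrite subr_ge0 => /(_ (ltW uv)); nra.
have hexN (u v : R) : hexnorm u v = hexnorm (- u) (- v) by rewrite /hexnorm; ring.
have [aa|/ltW aa] := leP a a'; have [bb|/ltW bb] := leP b b'.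
- by rewrite hexN !opprB; apply: le_trans n'T; apply: mono; lra.
- by rewrite hexN opprB; apply: (anti _ _ a' b' a b) => //; lra.
- by rewrite -(opprB b'); apply: (anti _ _ a b a' b') => //; lra.
- by apply: le_trans nT; apply: mono; lra.
Qed.

Lemma hexnorm_sector (x y x' y' T : R) :
  hexsector x y = hexsector x' y' ->
  hexnorm x y <= T -> hexnorm x' y' <= T -> hexnorm (x - x') (y - y') <= T.
Proof.
(* [cone k] gives the coordinates along the two rays bounding sector [k], again at 60 degrees; it
   preserves the form and takes the sector into the first quadrant. *)
pose cone k (x y : R) := match k with
  | 0%N => (x, y) | 1%N => (- x, x + y) | 2%N => (y, - (x + y))
  | 3%N => (- x, - y) | 4%N => (x, - (x + y)) | _ => (- y, x + y) end.
have coneN k (a b : R) : hexnorm (cone k a b).1 (cone k a b).2 = hexnorm a b.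
  by case: k => [|[|[|[|[|k]]]]]; rewrite /hexnorm /=; ring.
have coneB k (a b a' b' : R) :
    cone k (a - a') (b - b') =
    ((cone k a b).1 - (cone k a' b').1, (cone k a b).2 - (cone k a' b').2).
  by case: k => [|[|[|[|[|k]]]]]; congr (_, _) => /=; ring.
have cone_ge0 (a b : R) :
    0 <= (cone (hexsector a b) a b).1 /\ 0 <= (cone (hexsector a b) a b).2.
  rewrite /hexsector.
  by case: (leP 0 b) => ?; case: (leP 0 a) => ?; case: (leP a 0) => ?;
    case: (leP 0 (a + b)) => ?; case: (leP (a + b) 0) => ? /=; split; lra.
move=> E; rewrite -(coneN (hexsector x y) x) -(coneN (hexsector x y) x').
rewrite -(coneN (hexsector x y) (x - x')) coneB /=.
have [? ?] := cone_ge0 x y; have [? ?] := cone_ge0 x' y'.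
by apply: hexnorm_quadrant; rewrite // E.
Qed.

(* With p as first axis and 60 degrees between the axes, u - c has coordinates
   hexx c p u, hexy c p u, up to the factor |p - c|^2. *)
Definition hexy c p u : R :=
  2 / Num.sqrt 3 * ((p.1 - c.1) * (u.2 - c.2) - (p.2 - c.2) * (u.1 - c.1)).
Definition hexx c p u : R :=
  (p.1 - c.1) * (u.1 - c.1) + (p.2 - c.2) * (u.2 - c.2) - hexy c p u / 2.

Lemma hexnorm_sqdist c p u v :
  hexnorm (hexx c p u - hexx c p v) (hexy c p u - hexy c p v) =
  sqdist p c * sqdist u v.
Proof.
rewrite /hexx /hexy /hexnorm /sqdist.
have : Num.sqrt 3 ^- 2 = 3^-1 :> R by rewrite sqr_sqrtr.
rewrite -exprVn; move: (Num.sqrt 3)^-1 => k k2.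
have key (a b d e f g : R) :
    (a * b + d * e - 2 * k * (a * e - d * b) / 2 -
     (a * f + d * g - 2 * k * (a * g - d * f) / 2)) ^+ 2 +
    (a * b + d * e - 2 * k * (a * e - d * b) / 2 -
     (a * f + d * g - 2 * k * (a * g - d * f) / 2)) *
     (2 * k * (a * e - d * b) - 2 * k * (a * g - d * f)) +
    (2 * k * (a * e - d * b) - 2 * k * (a * g - d * f)) ^+ 2 =
    (a * (b - f) + d * (e - g)) ^+ 2 +
    3 * k ^+ 2 * (a * (e - g) - d * (b - f)) ^+ 2 by field.
by rewrite key k2; field.
Qed.

(** The sectors are taken around [c] with the first point [p] on an axis. Points in one sector are
    within [tau] of each other, and [p] lies on the ray shared by two sectors; the other five points
    are left with four sectors. *)
Lemma six_points c (tau : R) (f : 'I_6 -> R * R) :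
  (forall i, dist c (f i) <= tau) ->
  (forall i j, i != j -> tau < dist (f i) (f j)) -> False.
Proof.
move=> near far; pose p := f ord0.
have tau0 : 0 <= tau := le_trans (dist_ge0 _ _) (near ord0).
have p0 : 0 < sqdist p c.
  rewrite lt_neqAle sqdist_ge0 andbT eq_sym; apply/negP=> /eqP pc.
  have {}pc : c = p.
    move/eqP: pc; rewrite paddr_eq0 ?sqr_ge0 // !sqrf_eq0 !subr_eq0.
    by case/andP=> /eqP p1 /eqP p2; rewrite [c]surjective_pairing -p1 -p2 -surjective_pairing.
  have := far ord0 (lift ord0 ord0) isT.
  by rewrite -/p -pc ltNge near.
pose sec u := hexsector (hexx c p u) (hexy c p u).
have hexc : hexx c p c = 0 /\ hexy c p c = 0.
  have y0 : hexy c p c = 0 by rewrite /hexy !subrr !mulr0 subrr mulr0.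
  by rewrite /hexx y0 !subrr !mulr0 mul0r subr0 addr0.
have norm_le i : hexnorm (hexx c p (f i)) (hexy c p (f i)) <= sqdist p c * tau ^+ 2.
  case: hexc => x0 y0; have := hexnorm_sqdist c p (f i) c.
  rewrite x0 y0 !subr0 => ->; rewrite ler_pM2l // -dist_le // dist_sym; exact: near.
have contra i j : i != j ->
    hexnorm (hexx c p (f i) - hexx c p (f j)) (hexy c p (f i) - hexy c p (f j))
      <= sqdist p c * tau ^+ 2 -> False.
  move=> ij; rewrite hexnorm_sqdist ler_pM2l // -dist_le // => fij.
  by have := far i j ij; rewrite ltNge fij.
have sec_inj i j : i != j -> sec (f i) != sec (f j).
  by move=> ij; apply/eqP=> E; apply: (contra _ _ ij); apply: hexnorm_sector.
have yp : hexy c p p = 0 by rewrite /hexy; ring.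
have xp : hexx c p p = sqdist p c.
  by rewrite /hexx yp mul0r subr0 /sqdist !expr2.
have sec14 i : i != ord0 -> sec (f i) \in iota 1 4.
  move=> i0; have := sec_inj _ _ i0; rewrite -/p /sec {2}/hexsector yp xp lexx ltW //.
  have : hexsector (hexx c p (f i)) (hexy c p (f i)) != 5%N.
    apply/negP=> h5.
    (* p also lies on the boundary of the last sector *)
    apply: (contra _ _ i0); rewrite -/p xp yp subr0.
    have := norm_le ord0; rewrite -/p xp yp; move: (norm_le i) h5.
    move: (hexx _ _ _) (hexy _ _ _) (_ * _ : R) => x y T nT h5 nD.
    have [y0 s0] : y <= 0 /\ 0 <= x + y.
      move: h5; rewrite /hexsector.
      by case: (leP 0 y) => y0; case: (leP 0 x) => x0; case: (leP x 0) => x1;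
        case: (leP 0 (x + y)) => s0; case: (leP (x + y) 0) => s1 // _; split; lra.
    (* [(- y, x + y)] and [(0, sqdist p c)] are the coordinates of [f i] and [p] along the rays
       bounding the last sector. *)
    have := @hexnorm_quadrant (- y) (x + y) 0 (sqdist p c) T.
    rewrite oppr_ge0 => /(_ y0 s0 (lexx 0) (ltW p0)); move: nT nD.
    by rewrite /hexnorm; lra.
  by rewrite /hexsector; do !case: ifP => //.
have : uniq [seq sec (f (lift ord0 i)) | i : 'I_5].
  rewrite map_inj_uniq ?enum_uniq // => i j E; apply/eqP; apply: contraT => ij.
  have lij : lift ord0 i != lift ord0 j by rewrite (inj_eq lift_inj).
  by have := sec_inj _ _ lij; rewrite E eqxx.
move=> sec_uniq; have := @uniq_leq_size _ _ (iota 1 4) sec_uniq.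
rewrite size_map size_enum_ord => H; suff: (5 <= 4)%N by [].
by apply: H => _ /mapP[i _ ->]; apply: sec14; rewrite eq_sym neq_lift.
Qed.

End Distance.

(** * The 2-RNG and networks with one Steiner point *)

Section LmaxBounds.
Context (R : realType).
Local Open Scope ring_scope.

Lemma edge_le_lmax (P : seq (R * R)) (G : graph 'I_(size P)) i j :
  adj G i j -> dist (pos P i) (pos P j) <= lmax G.
Proof.
by move=> ij; rewrite /lmax (bigD1 (i, j)) //= le_max lexx.
Qed.

Lemma lmax_le (P : seq (R * R)) (G : graph 'I_(size P)) (rho : R) :
  0 <= rho -> (forall i j, adj G i j -> dist (pos P i) (pos P j) <= rho) ->
  lmax G <= rho.
Proof.
move=> rho0 Grho; rewrite /lmax; elim/big_rec: _ => // e x eG xrho.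
by rewrite ge_max xrho andbT; apply: Grho.
Qed.

End LmaxBounds.

Section Rng.
Context (R : realType) (P : seq (R * R)) (G : graph 'I_(size P)) (tau : R).
Hypothesis rngG : forall i j : 'I_(size P),
  rng_adj i j -> (dist (pos P i) (pos P j) <= tau)%R -> adj G i j.

(* A pair missing from the 2-RNG has two points in its lune, at least one of
   which avoids S and replaces the pair by two strictly shorter ones. *)
Lemma rng_connect (S : {set 'I_(size P)}) i j :
  #|S| < 2 -> i \notin S -> j \notin S ->
  (dist (pos P i) (pos P j) <= tau)%R -> connect (adj (del G S)) i j.
Proof.
move=> S2; pose d (i j : 'I_(size P)) := dist (pos P i) (pos P j).
pose shorter i j := [set e : 'I_(size P) * 'I_(size P) | (d e.1 e.2 < d i j)%R].
(* Induction on the distance, measured by the finite number of strictly closer pairs. *)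
move: {2}_.+1 (ltnSn #|shorter i j|) => m.
elim: m i j => // m IHm i j lt_m iS jS ij.
have [->|neq_ij] := eqVneq i j; first exact: connect0.
have [rij|] := boolP (rng_adj i j).
  by apply: connect1; apply/and3P; split=> //; apply: rngG.
rewrite /rng_adj neq_ij /= -leqNgt => lune2.
have [k] : exists k, k \in open_lune i j :\: S.
  apply/set0Pn; rewrite -card_gt0 cardsD subn_gt0.
  apply: leq_ltn_trans (subset_leq_card (subsetIr _ _)) _.
  exact: leq_trans S2 lune2.
rewrite !inE => /andP[kS /andP[ki kj]].
have step a b : (d a b < d i j)%R -> a \notin S -> b \notin S ->
    connect (adj (del G S)) a b.
  move=> ab aS bS; apply: IHm => //; last exact: le_trans (ltW ab) ij.
  rewrite -ltnS; apply: leq_trans lt_m; rewrite ltnS; apply: proper_card.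
  apply/properP; split.
    by apply/subsetP=> e; rewrite !inE => /lt_trans; apply.
  by exists (a, b); rewrite !inE /= ?ltxx.
apply: connect_trans (step i k _ iS kS) (step k j _ kS jS) => //.
by rewrite /d dist_sym.
Qed.

Lemma rng_connect1 (z i j : 'I_(size P)) :
  i != z -> j != z -> (dist (pos P i) (pos P j) <= tau)%R ->
  connect (adj (del G [set z])) i j.
Proof. by move=> iz jz; apply: rng_connect; rewrite ?cards1 ?inE. Qed.

Lemma rng_connect0 (i j : 'I_(size P)) :
  (dist (pos P i) (pos P j) <= tau)%R -> connect (adj G) i j.
Proof. by move=> ij; rewrite -connect_del0; apply: rng_connect; rewrite ?cards0 ?inE. Qed.

End Rng.

Section DiskGraph.
Context (R : realType) (P : seq (R * R)) (rho : R).

Definition disk_adj : rel 'I_(size P) :=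
  fun i j => (i != j) && (dist (pos P i) (pos P j) <= rho)%R.

Lemma disk_adj_sym : symmetric disk_adj.
Proof. by move=> i j; rewrite /disk_adj eq_sym dist_sym. Qed.

Lemma disk_adj_irr : irreflexive disk_adj.
Proof. by move=> i; rewrite /disk_adj eqxx. Qed.

Lemma disk_adj_verts (i j : 'I_(size P)) :
  disk_adj i j -> i \in [set: 'I_(size P)].
Proof. by rewrite inE. Qed.

Definition disk_graph : graph 'I_(size P) :=
  Graph disk_adj_sym disk_adj_irr disk_adj_verts.

Lemma lmax_disk_graph : (0 <= rho -> lmax disk_graph <= rho)%R.
Proof. by move=> rho0; apply: lmax_le => // i j /andP[]. Qed.

End DiskGraph.

Section Steiner.
Context (R : realType) (X : seq (R * R)) (s : R * R).
Local Notation Y := (X ++ [:: s]).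

Lemma size_steiner : size Y = (size X).+1.
Proof. by rewrite size_cat addn1. Qed.

Lemma steiner_subproof : size X < size Y.
Proof. by rewrite size_steiner. Qed.

Definition terminal (i : 'I_(size X)) : 'I_(size Y) :=
  widen_ord (ltnW steiner_subproof) i.
Definition steiner : 'I_(size Y) := Ordinal steiner_subproof.

Lemma steinerP (y : 'I_(size Y)) : y = steiner \/ exists i, y = terminal i.
Proof.
have := ltn_ord y; rewrite {2}size_steiner ltnS leq_eqVlt => /orP[/eqP yX|yX].
  by left; apply: val_inj.
by right; exists (Ordinal yX); apply: val_inj.
Qed.

Lemma terminal_inj : injective terminal.
Proof. by move=> i j [ij]; apply: val_inj. Qed.

Lemma terminal_neq i : terminal i != steiner.
Proof. by rewrite -val_eqE /= ltn_eqF. Qed.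

Lemma pos_terminal i : pos Y (terminal i) = pos X i.
Proof. by rewrite /pos nth_cat /= ltn_ord. Qed.

Lemma pos_steiner : pos Y steiner = s.
Proof. by rewrite /pos nth_cat /= ltnn subnn. Qed.

(** * Adding a Steiner point to a connected graph *)

Section Add.
Context (G : graph 'I_(size X)) (rho r : R).
Hypothesis X2 : 1 < size X.
Hypothesis Gconn : forall i j, connect (adj G) i j.
Hypothesis Grho : forall i j, adj G i j -> (dist (pos X i) (pos X j) <= rho)%R.
Hypothesis r_rho : (r <= rho)%R.
Hypothesis reach : forall v w, w != v -> exists q,
  connect (adj (del G [set v])) w q /\ (dist s (pos X q) <= r)%R.

(** Without the new vertex [G] is still connected; without a terminal [v], every other terminal
    walks in [G] to a point within [r] of [s] and from there to the new vertex. *)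
Lemma two_connected_disk_graph : two_connected (disk_graph Y rho).
Proof.
left; apply/kconnected2P => //; first by rewrite card_ord size_steiner.
have edge (z : 'I_(size Y)) i j : terminal i != z -> terminal j != z ->
    adj G i j -> adj (del (disk_graph Y rho) [set z]) (terminal i) (terminal j).
  move=> iz jz ij; rewrite del1E iz jz andbT /= /disk_adj !pos_terminal Grho //.
  by rewrite (inj_eq terminal_inj) ?andbT; apply: contraTneq ij => ->; rewrite adj_irr.
move=> z u w; have [->|[v ->]] := steinerP z.
  have [->|[i ->]] := steinerP u; first by rewrite eqxx.
  have [->|[j ->]] := steinerP w; first by rewrite eqxx.
  move=> _ _; apply: connect_homo (Gconn i j) => a b ab.
  by apply/connect1/edge => //; apply: terminal_neq.
suff to_steiner y : y != terminal v ->
    connect (adj (del (disk_graph Y rho) [set terminal v])) y steiner.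
  move=> /to_steiner us /to_steiner ws; apply: connect_trans us _.
  by rewrite connect_sym_adj.
have [->|[i ->]] := steinerP y; first by rewrite connect0.
rewrite (inj_eq terminal_inj) => iv; have [q [iq qs]] := reach iv.
have qv : q != v.
  by have := connect_del_notin iq; rewrite !inE => ->.
apply: (@connect_trans _ _ (terminal q)).
  apply: connect_homo iq => a b; rewrite del1E => /and3P[ab av bv].
  by apply/connect1/edge; rewrite ?(inj_eq terminal_inj).
apply: connect1; rewrite del1E (inj_eq terminal_inj) qv eq_sym terminal_neq /=.
rewrite /disk_adj pos_terminal pos_steiner dist_sym (le_trans qs) //.
by rewrite terminal_neq.
Qed.

End Add.

(** * Removing the Steiner point of a 2-connected network *)

Section Remove.
Context (N : graph 'I_(size Y)) (G : graph 'I_(size X)) (tau : R).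
Hypotheses (X2 : 1 < size X) (NT : verts N = setT).
Hypothesis tcN : two_connected N.
Hypothesis Ntau : (lmax N <= tau)%R.
Hypothesis rngG : forall i j : 'I_(size X),
  rng_adj i j -> (dist (pos X i) (pos X j) <= tau)%R -> adj G i j.

Lemma network_connect z u w :
  u != z -> w != z -> connect (adj (del N [set z])) u w.
Proof.
have Y3 : 2 < size Y by rewrite size_steiner.
case: tcN => [/(kconnected2P NT)|[_]]; first by rewrite card_ord; apply.
by rewrite NT cardsT card_ord => -[] YE; rewrite YE in Y3.
Qed.

Lemma network_edge i j :
  adj N (terminal i) (terminal j) -> (dist (pos X i) (pos X j) <= tau)%R.
Proof. by move=> /edge_le_lmax; rewrite !pos_terminal => /le_trans; apply. Qed.

(** A walk of the network that avoids the Steiner point uses only edges of length at most [tau], and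
    each of them can be replaced by a walk in [G]. *)
Lemma remove_connect i j : connect (adj G) i j.
Proof.
pose P y := exists2 k, y = terminal k & connect (adj G) i k.
suff [k /terminal_inj ->] : P (terminal j) by [].
apply: (connect_ind_closed (P := P))
    (network_connect (terminal_neq i) (terminal_neq j)) _; last by exists i.
move=> y y'; rewrite del1E => /and3P[yy' _ y's] [k yE ik]; subst y.
case: (steinerP y') y's yy' => [->|[k' ->]]; first by rewrite eqxx.
move=> _ /network_edge kk'; exists k' => //.
by apply: connect_trans ik (rng_connect0 rngG kk').
Qed.

(** A walk of the network from [u] to the Steiner point without [c] stays in the interior of [A]
    until it arrives, since its edges between terminals can be replaced by walks of [G] without [c];
    [q] is the last terminal. The bound is the exact bottleneck, as needed for the radius of the
    disk. *)
Lemma leaf_near_steiner A c u : leaf G A c -> u \in A :\ c ->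
  exists2 q, q \in A :\ c & (dist s (pos X q) <= lmax N)%R.
Proof.
move=> lA uA; pose P y := (exists2 k, y = terminal k & k \in A :\ c) \/
  exists2 q, q \in A :\ c & (dist s (pos X q) <= lmax N)%R.
have cs : steiner != terminal c by rewrite eq_sym terminal_neq.
have uc : terminal u != terminal c.
  by rewrite (inj_eq terminal_inj); move: uA; rewrite !inE => /andP[].
have : P steiner.
  apply: (connect_ind_closed (P := P)) (network_connect uc cs) _; last by left; exists u.
  move=> y y'; rewrite del1E => /and3P[yy' _ y'c] [[k yE kA]|]; last by right.
  subst y; case: (steinerP y') yy' y'c => [->|[k' ->]] kk'.
    by move=> _; right; exists k => //; have := edge_le_lmax kk';
      rewrite pos_terminal pos_steiner dist_sym.
  rewrite (inj_eq terminal_inj) => k'c; left; exists k' => //.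
  have kc : k != c by move: kA; rewrite !inE => /andP[].
  have kk'c := rng_connect1 rngG kc k'c (network_edge kk').
  exact: (leaf_closed remove_connect lA kk'c kA).
by case=> // -[k /esym/eqP]; rewrite (negPf (terminal_neq k)).
Qed.

(** Each leaf block has an interior vertex within [tau] of the Steiner point. Two of these within
    [tau] of each other would be joined in [G] without the cut-vertex of one block, hence lie in the
    same block; so six of them contradict the packing bound. *)
Lemma leaves_lt6 (A : 'I_6 -> {set 'I_(size X)}) (c u : 'I_6 -> 'I_(size X)) :
  injective A -> (forall i, leaf G (A i) (c i)) -> (forall i, u i \in A i :\ c i) ->
  False.
Proof.
move=> A_inj lA uA.
have near i : exists q, (q \in A i :\ c i) && (dist s (pos X q) <= tau)%R.
  have [q qA qs] := leaf_near_steiner (lA i) (uA i).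
  by exists q; rewrite qA (le_trans qs).
pose q i := xchoose (near i).
have qA i : q i \in A i :\ c i by have /andP[] := xchooseP (near i).
apply: (@six_points _ s tau (fun i => pos X (q i))) => [i|i j ij].
  by have /andP[] := xchooseP (near i).
rewrite ltNge; apply: contra ij => qij; apply/eqP/A_inj.
have cutq k : ~~ cutb G (q k).
  by have := qA k; rewrite !inE => /andP[qc qAk]; apply: leaf_noncut (lA k) qAk qc.
have ncj : q j != c i by apply: contraNneq (cutq j) => ->; case: (lA i).
have qjA : q j \in A i :\ c i.
  have qc : q i != c i by have := qA i; rewrite !inE => /andP[].
  exact: (leaf_closed remove_connect (lA i) (rng_connect1 rngG qc ncj qij) (qA i)).
have mc k : mclique G (A k) by case: (lA k).
have inA a b : q a \in A b :\ c b -> q a \in A b by rewrite inE => /andP[].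
rewrite (mclique_noncut remove_connect (cutq j) (mc i) (inA _ _ qjA)).
by rewrite (mclique_noncut remove_connect (cutq j) (mc j) (inA _ _ (qA j))).
Qed.

End Remove.

End Steiner.

(** * Block cut forests *)

Definition ncuts (cuts B : seq nat) := count (fun v => v \in cuts) B.

Section Forest.
Context (n : nat) (E : seq (nat * nat)) (F : bcforest).
Local Notation G := (graph_of n E).
Local Notation blocks := (flatten (map fst F)).
Local Notation cuts := (flatten (map snd F)).
Hypothesis FG : is_bcforest G F.

Let GT : verts G = setT. Proof. by []. Qed.

Lemma forest_blockP A : (A \in map (vset n) blocks) <-> mclique G A.
Proof. by case: FG => _ [_ FP] _ _ _; rewrite -(blockP GT); apply: FP. Qed.

Lemma forest_block_uniq : uniq (map (vset n) blocks).
Proof. by case: FG => _ []. Qed.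

Lemma forest_block B : B \in blocks -> uniq B /\ {in B, forall i, i < n}.
Proof.
case: FG => /andP[/allP bl _] _ _ _ _ /bl /andP[Bu /allP Bn]; by split.
Qed.

Lemma card_forest_block B : B \in blocks -> #|vset n B| = size B.
Proof.
move=> /forest_block[Bu Bn].
rewrite cardE -(size_map val); apply: perm_size; apply: uniq_perm => //.
  by rewrite map_inj_uniq ?enum_uniq //; apply: val_inj.
move=> i; apply/mapP/idP => [[j]|iB]; first by rewrite mem_enum inE => jB ->.
by exists (Ordinal (Bn i iB)); rewrite ?mem_enum ?inE.
Qed.

Lemma forest_block_mclique B : B \in blocks -> mclique G (vset n B).
Proof. by move=> FB; apply/forest_blockP/map_f. Qed.

Lemma forest_cutsE (v : 'I_n) : (v : nat) \in cuts = cutb G v.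
Proof.
case: FG => _ _ [_ cP] _ _; apply/idP/idP => [/cP[w cw /val_inj->]|cv].
  exact/(cutP GT).
by apply/cP; exists v => //; apply/(cutP GT).
Qed.

Lemma forest_cuts_size : size cuts <= n.
Proof.
case: FG => /andP[_ /allP cn] _ [cu _] _ _.
rewrite -(size_iota 0 n); apply: uniq_leq_size => // i /cn.
by rewrite mem_iota.
Qed.

Lemma forest_size : size F <= n.
Proof.
case: FG => _ _ _ [Fu FP] _.
pose comp (u : 'I_n) := [set v in verts G | connect (adj G) u v].
rewrite -(size_map (fun T : bctree => vset n (flatten T.1))).
rewrite -[n in _ <= n]card_ord cardE -(size_map comp); apply: uniq_leq_size => //.
by move=> A /FP[u _ ->]; apply: map_f; rewrite mem_enum.
Qed.

Lemma forest_connected : 0 < n ->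
  (size F == 1) <-> (forall x y : 'I_n, connect (adj G) x y).
Proof.
move=> n0; case: FG => _ _ _ FP _.
pose comp (u : 'I_n) := [set v in verts G | connect (adj G) u v].
rewrite -(size_map (fun T : bctree => vset n (flatten T.1))); split=> [F1 x y|conn].
  case: FP => _ FP; move: F1 FP; case: (map _ F) => // A [|//] _ FP.
  have cA u : comp u = A.
    suff : comp u \in [:: A] by rewrite inE => /eqP.
    by apply/FP; exists u; rewrite ?inE.
  have : y \in comp y by rewrite !inE connect0.
  by rewrite cA -(cA x) !inE.
apply/eqP/(lists_size1 FP (a := setT)).
  by exists (Ordinal n0); [rewrite inE | apply/setP=> x; rewrite !inE conn].
by move=> A [u _ ->]; apply/setP=> x; rewrite !inE conn.
Qed.

Lemma forest_total_size : edge_list n E ->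
  \sum_(B <- blocks) size B <= n + 2 * size E.
Proof.
move=> /andP[Eu /allP En].
have -> : \sum_(B <- blocks) size B = \sum_(A <- map (vset n) blocks) #|A|.
  by rewrite big_map; apply: eq_big_seq => B /card_forest_block.
have clS : {in map (vset n) blocks, forall A, mclique G A} by move=> A /forest_blockP.
have := sum_card_mclique forest_block_uniq clS; rewrite card_ord => /leq_trans; apply.
rewrite leq_add2l.
have -> : \sum_x #|[set y | adj G x y]| =
    #|[set e : 'I_n * 'I_n | adj G e.1 e.2]|.
  rewrite -[RHS]sum1_card; under [LHS]eq_bigr => x _ do rewrite -sum1_card.
  by rewrite pair_big_dep; apply: eq_bigl => e; rewrite !inE.
rewrite cardE -(size_map (fun e : 'I_n * 'I_n => (e.1 : nat, e.2 : nat))).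
have -> : 2 * size E = size (E ++ [seq (e.2, e.1) | e <- E]).
  by rewrite size_cat size_map addnn mul2n.
apply: uniq_leq_size.
  by rewrite map_inj_uniq ?enum_uniq // => -[a b] [c d] [/val_inj-> /val_inj->].
move=> e /mapP[[a b]]; rewrite mem_enum inE => /andP[_ /orP[]] ab ->;
  rewrite mem_cat ?ab //.
by apply/orP; right; apply/mapP; exists (b : nat, a : nat).
Qed.

Section ConnectedForest.
Hypothesis Gconn : forall x y : 'I_n, connect (adj G) x y.

Lemma forest_leafP B : B \in blocks ->
  (ncuts cuts B == 1) <-> exists c, leaf G (vset n B) c.
Proof.
move=> FB; have [Bu Bn] := forest_block FB.
rewrite /ncuts -size_filter; split=> [|[c [_ cB cc c1]]].
  case cutB: (filter _ _) => [|i [|]] // _.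
  have : i \in [seq v <- B | v \in cuts] by rewrite cutB inE.
  rewrite mem_filter => /andP[ic iB]; exists (Ordinal (Bn i iB)); split.
  - exact: forest_block_mclique.
  - by rewrite inE.
  - by rewrite -forest_cutsE.
  - move=> x; rewrite inE => xB; rewrite -forest_cutsE => xc; apply: val_inj.
    apply/eqP; rewrite /=; have : (x : nat) \in [:: i] by rewrite -cutB mem_filter xc.
    by rewrite inE.
rewrite inE in cB.
apply/eqP; apply: (@lists_size1 _ _ (fun i : nat => i = c) (c : nat)) => //.
  split; first exact: filter_uniq.
  move=> i; rewrite mem_filter; split=> [/andP[ic iB]|->].
    have := c1 (Ordinal (Bn i iB)); rewrite inE -forest_cutsE => /(_ iB ic).
    by move=> /(congr1 val).
  by rewrite cB forest_cutsE cc.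
Qed.

(** The cut-vertex [c] has a neighbour, and if [A] were [[set c]], maximality would put this
    neighbour into it. *)
Lemma leaf_interior A c : leaf G A c -> exists u, u \in A :\ c.
Proof.
case=> -[_ _ maxA] cA /existsP[u /existsP[_ /andP[uc _]]] _.
have [/existsP[a /andP[ac aA]]|noA] := boolP [exists a, (a != c) && (a \in A)].
  by exists a; rewrite !inE ac.
have /connectP[[|y p] /=] := Gconn c u; first by move=> _ cu; rewrite cu eqxx in uc.
move=> /andP[cy _] _; have yc : y != c by apply: contraTneq cy => ->; rewrite list_adj_irr.
suff yA : y \in A by case/existsP: noA; exists y; rewrite yc.
apply: maxA => a aA; have [->|ac] := eqVneq a c; first by rewrite insep_sym insep_adj.
by case/existsP: noA; exists a; rewrite ac.
Qed.

Lemma forest_isolated B : B \in blocks -> ncuts cuts B == 0 ->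
  forall v, ~~ cutb G v.
Proof.
move=> FB; rewrite /ncuts eqn0Ngt -has_count => /hasPn nocut.
have noB v : v \in vset n B -> ~~ cutb G v.
  by rewrite inE -forest_cutsE; apply: nocut.
have clB := forest_block_mclique FB; have [/set0Pn[u uB] _ _] := clB.
move=> v; apply: (noB v).
pose P v := v \in vset n B.
apply: (connect_ind_closed (P := P)) (Gconn u v) uB => a b ab aB.
rewrite /P (mclique_noncut Gconn (noB a aB) clB aB) inE insep_sym.
exact: insep_adj.
Qed.

Lemma forest_single : 0 < n -> (size blocks == 1) <-> (forall v, ~~ cutb G v).
Proof.
move=> n0; split=> [F1 v|nocut].
  have mcl_eq A : mclique G A -> map (vset n) blocks = [:: A].
    move=> /forest_blockP; move: F1; rewrite -(size_map (vset n)).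
    by case: (map _ _) => [|A' []] //= _; rewrite inE => /eqP ->.
  apply/negP=> cv; have /existsP[u /existsP[w /and4P[uv wv _ uwv]]] := cv.
  (* Both sides of [v] contain the interior of a leaf block. With a single block these interiors
     coincide, which joins the two sides. *)
  have [A [c [x [lA xA Au]]]] := leaf_exists Gconn cv uv.
  have [A' [c' [x' [lA' xA' Aw]]]] := leaf_exists Gconn cv wv.
  have AA' : A = A'.
    have [clA _ _ _] := lA; have [clA' _ _ _] := lA'.
    by have := mcl_eq A clA; rewrite (mcl_eq A' clA') => -[].
  subst A'; have cc : c' = c by case: lA => _ _ _; case: lA' => _ ? ? _; apply.
  subst c'; case/negP: uwv; apply: connect_trans (Au x xA) _.
  by rewrite connect_sym_adj; apply: Aw.
apply/eqP; rewrite -(size_map (vset n)).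
have [A clA _] := mclique_mem G (Ordinal n0).
apply: (@lists_size1 _ _ (mclique G) A) => // [|A' clA'].
  by split; [apply: forest_block_uniq | apply: forest_blockP].
by rewrite (noncut_mclique_setT Gconn nocut clA') (noncut_mclique_setT Gconn nocut clA).
Qed.

End ConnectedForest.

End Forest.

(** * The binary search *)

Lemma traverseC_val (A B : Type) (f : A -> cost B) s :
  (traverseC f s).1 = map (fun x => (f x).1) s.
Proof. by elim: s => //= x s ->. Qed.

Lemma bC_val blocks cuts :
  (bC blocks cuts).1 = count (fun B => ncuts cuts B == 1) blocks +
                       2 * count (fun B => ncuts cuts B == 0) blocks.
Proof. by rewrite /bC /= traverseC_val !count_map. Qed.

Section LeafPoints.
Context (R : realType) (X : seq (R * R)) (blocks : seq (seq nat)) (cuts : seq nat).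
Local Notation Q := (leaf_pointsC X blocks cuts).1.

Lemma leaf_pointsC_val :
  Q = flatten [seq if ncuts cuts (nth [::] blocks k) == 1 then
                     [seq (pos X v, k) | v <- nth [::] blocks k & v \notin cuts]
                   else [::] | k <- iota 0 (size blocks)].
Proof.
rewrite /leaf_pointsC /= traverseC_val; congr flatten; apply: eq_map => k /=.
by rewrite /ncuts; case: ifP.
Qed.

Lemma leaf_pointsP p k :
  (p, k) \in Q <->
  [/\ k < size blocks, ncuts cuts (nth [::] blocks k) == 1 &
      exists v, [/\ v \in nth [::] blocks k, v \notin cuts & p = pos X v]].
Proof.
rewrite leaf_pointsC_val; split=> [/flatten_mapP[k']|[kb nk [v [vB vc ->]]]].
  rewrite mem_iota add0n /= => k'b; case: ifP => // nk /mapP[v].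
  by rewrite mem_filter => /andP[vc vB] [-> ->]; split=> //; exists v.
apply/flatten_mapP; exists k; first by rewrite mem_iota.
by rewrite nk; apply: map_f; rewrite mem_filter vc.
Qed.

Lemma leaf_points_colours :
  size (undup (map snd Q)) <= count (fun B => ncuts cuts B == 1) blocks.
Proof.
have -> : count (fun B => ncuts cuts B == 1) blocks =
    size [seq k <- iota 0 (size blocks) | ncuts cuts (nth [::] blocks k) == 1].
  rewrite size_filter -[in LHS](mkseq_nth [::] blocks) /mkseq count_map.
  exact: eq_count.
apply: uniq_leq_size; first exact: undup_uniq.
move=> k; rewrite mem_undup => /mapP[[p k'] /leaf_pointsP[kb nk _] ->].
by rewrite mem_filter nk mem_iota.
Qed.

End LeafPoints.

Lemma median_bounds (R : realType) (pr : procedures R) lo hi :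
  known_procedures pr -> lo < hi -> lo <= median pr lo hi < hi.
Proof. by move=> Hpr lohi; case: (median_spec Hpr lohi) => ->; lia. Qed.

Section Threshold.
Context (R : realType) (pr : procedures R) (Hpr : known_procedures pr).
Context (X : seq (R * R)) (E : seq (nat * nat)) (X2 : 1 < size X).
Hypothesis EX : represents E (rng2_graph X).

Definition short_edges t := [seq e <- E | (edge_length X e <= t)%R].

Lemma short_edges_list t : edge_list (size X) (short_edges t).
Proof.
case: EX => /andP[Eu /allP En] _; apply/andP; split; first exact: filter_uniq.
by apply/allP=> e; rewrite mem_filter => /andP[_ /En].
Qed.

Lemma short_edgesE t (i j : 'I_(size X)) :
  adj (graph_of (size X) (short_edges t)) i j =
  rng_adj i j && (dist (pos X i) (pos X j) <= t)%R.
Proof.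
case: EX => _ /(_ i j) /= <-; rewrite /list_adj !mem_filter /edge_length /=.
by rewrite (dist_sym (pos X j)) -andb_orr -!andbA [X in _ && X = _]andbC.
Qed.

Definition forest_at t := (bcforestC pr (size X) (short_edges t)).1.

Definition disk_at t :=
  (diskC pr X (short_edges t) (flatten (map fst (forest_at t)))
    (flatten (map snd (forest_at t)))).1.

(** * One threshold: the test and the disk *)

Section Fixed.
Context (t : R).
Local Notation Et := (short_edges t).
Local Notation G := (graph_of (size X) Et).
Local Notation F := (forest_at t).
Local Notation blocks := (flatten (map fst F)).
Local Notation cuts := (flatten (map snd F)).
Local Notation C := (disk_at t).

Definition feasible := ~~ ((5 < (bC blocks cuts).1) || (size F != 1)).

Lemma short_forest : is_bcforest G F.
Proof.
have [c cP] := bcforestC_spec Hpr.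
by have [] := cP (size X) Et (ltnW X2) (short_edges_list t).
Qed.

Let n0 : 0 < size X := ltnW X2.

Lemma feasible_connected : feasible -> forall i j, connect (adj G) i j.
Proof.
by rewrite /feasible negb_or negbK => /andP[_ /(forest_connected short_forest n0)].
Qed.

Lemma connected_edge :
  (forall i j, connect (adj G) i j) -> exists i j, adj G i j.
Proof.
move=> conn; have /connectP[[|j p] /=] := conn (Ordinal n0) (Ordinal X2).
  by move=> _ /(congr1 val).
by case/andP=> ij _ _; exists (Ordinal n0), j.
Qed.

Lemma connected_short_edges :
  (forall i j, connect (adj G) i j) -> 0 < size Et.
Proof.
move=> /connected_edge[i [j /andP[_]]].
by case/orP=> ij; rewrite lt0n size_eq0; apply/eqP=> E0; rewrite E0 in ij.
Qed.

Lemma leaf_pointsE p k :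
  (p, k) \in (leaf_pointsC X blocks cuts).1 <->
  k < size blocks /\ exists c q, let A := vset _ (nth [::] blocks k) in
    [/\ leaf G A c, q \in A :\ c & p = pos X q].
Proof.
split=> [/leaf_pointsP[kb nk [v [vB vc ->]]]|[kb [c [q [lA]]]]].
  have Bb : nth [::] blocks k \in blocks by rewrite mem_nth.
  have [c lA] := (forest_leafP short_forest Bb).1 nk.
  have [_ Bn] := forest_block short_forest Bb.
  split=> //; exists c, (Ordinal (Bn v vB)); split=> //.
  rewrite !inE /= vB andbT; apply: contraNneq vc => vc.
  rewrite -[v]/(val (Ordinal (Bn v vB))) vc (forest_cutsE short_forest).
  by case: lA.
rewrite !inE => /andP[qc qB] ->; have Bb : nth [::] blocks k \in blocks by rewrite mem_nth.
apply/leaf_pointsP; split=> //; first by apply/(forest_leafP short_forest Bb); exists c.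
exists (q : nat); split=> //; rewrite (forest_cutsE short_forest); apply: contra qc => cq.
by apply/eqP; case: lA => _ _ _; apply; rewrite ?inE.
Qed.

Lemma leaf_colour A c u : leaf G A c -> u \in A :\ c ->
  exists2 k, A = vset _ (nth [::] blocks k) &
    (pos X u, k) \in (leaf_pointsC X blocks cuts).1.
Proof.
move=> lA; have [clA _ _ _] := lA.
have /(forest_blockP short_forest) /mapP[B Bb AB] := clA; subst A.
move=> uB; exists (index B blocks); rewrite ?nth_index //.
by apply/leaf_pointsE; rewrite index_mem nth_index //; split=> //; exists c, u.
Qed.

(** A cut-vertex yields a leaf block and hence a point. The colours are leaf blocks, of which the
    test admits at most five; this is the constant number of colours required by the disk
    procedure. *)
Lemma leaf_points_spannable : feasible -> size blocks != 1 ->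
  let Q := (leaf_pointsC X blocks cuts).1 in
  0 < size Q /\ size (undup (map snd Q)) <= 5.
Proof.
move=> ft nb1 Q; have conn := feasible_connected ft; split.
  have [v cv] : exists v, cutb G v.
    apply/existsP; apply: contraR nb1 => /existsPn nocut.
    exact/(forest_single short_forest conn n0).
  have /existsP[w /existsP[_ /and4P[wv _ _ _]]] := cv.
  have [A [c' [u [lA uA _]]]] := leaf_exists conn cv wv.
  have [k _] := leaf_colour lA uA.
  by rewrite -/Q; case: Q.
apply: leq_trans (leaf_points_colours _ _ _) _.
move: ft; rewrite /feasible bC_val negb_or -leqNgt => /andP[b5 _].
exact: leq_trans (leq_addr _ _) b5.
Qed.

Lemma spanning_spec : feasible -> size blocks != 1 ->
  smallest_colour_spanning (leaf_pointsC X blocks cuts).1 C.1 C.2.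
Proof.
move=> ft nb1; have [Q0 Q5] := leaf_points_spannable ft nb1.
have [c cP] := spanningC_spec Hpr 5.
by rewrite /disk_at /diskC (negPf nb1); case: (cP _ Q0 Q5).
Qed.

(** What is needed to add the centre as a Steiner point. If there is no cut-vertex, an endpoint of
    the chosen edge survives the deletion; after deletion of a cut-vertex, each component contains
    the interior of a leaf block, which has a point in the disk. *)
Lemma disk_reach : feasible -> forall v w, w != v -> exists q,
  connect (adj (del G [set v])) w q /\ (dist C.1 (pos X q) <= C.2)%R.
Proof.
move=> ft; have conn := feasible_connected ft.
have [b1|nb1] := boolP (size blocks == 1).
  have nocut := (forest_single short_forest conn n0).1 b1.
  move=> v w wv; rewrite /disk_at /diskC b1 /=.
  have := pick_edge_spec Hpr (connected_short_edges conn).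
  move: (pick_edge pr Et) => e eE.
  have /andP[_ /allP/(_ e eE) /andP[e12 e2]] := short_edges_list t.
  have reach (q : 'I_(size X)) : q != v -> (q = e.1 :> nat \/ q = e.2 :> nat) -> exists q,
      connect (adj (del G [set v])) w q /\
      (dist (midpoint (pos X e.1) (pos X e.2)) (pos X q) <= edge_length X e / 2)%R.
    move=> qv qe; exists q; split; first exact: noncut_connect.
    case: qe => ->; first by rewrite dist_midpoint.
    by rewrite midpointC dist_midpoint dist_sym.
  have [ve1|ve1] := eqVneq (val v) e.1.
    apply: (reach (Ordinal e2)); last by right.
    by rewrite -val_eqE /= ve1 gtn_eqF.
  apply: (reach (Ordinal (ltn_trans e12 e2))); last by left.
  by rewrite -val_eqE /= eq_sym.
have [span _] := spanning_spec ft nb1.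
have near v w : cutb G v -> w != v -> exists q,
    connect (adj (del G [set v])) w q /\ (dist C.1 (pos X q) <= C.2)%R.
  move=> cv wv; have [A [c [u [lA uA Aw]]]] := leaf_exists conn cv wv.
  have [k Ak uQ] := leaf_colour lA uA.
  have [p pQ pC] := span k (map_f snd uQ).
  (* The point of this colour in the disk may differ from [u], but it is interior to the same leaf
     block, whose cut-vertex is unique. *)
  have [_ [c' [q []]]] := (leaf_pointsE _ _).1 pQ; rewrite -Ak => lA' qA' pq.
  exists q; rewrite -pq; split=> //; apply: Aw.
  suff -> : c = c' by [].
  by case: lA => _ cA cc _; case: lA' => _ _ _; apply.
move=> v w wv; have [cv|ncv] := boolP (cutb G v); first exact: near.
(* For a non-cut-vertex [v] any disk point other than [v] will do; one is found beyond a cut-vertex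
   [v0], on a side not containing [v]. *)
have [v0 cv0] : exists v, cutb G v.
  apply/existsP; apply: contraR nb1 => /existsPn nocut.
  exact/(forest_single short_forest conn n0).
have vv0 : v != v0 by apply: contraNneq ncv => ->.
have [y yv0 vy] : exists2 y, y != v0 & ~~ connect (adj (del G [set v0])) v y.
  have /existsP[y1 /existsP[y2 /and4P[y1x y2x _ y12]]] := cv0.
  have [vy1|] := boolP (connect (adj (del G [set v0])) v y1); last by exists y1.
  exists y2 => //; apply: contra y12 => vy2.
  by apply: connect_trans vy2; rewrite connect_sym_adj.
have [q [yq qC]] := near v0 y cv0 yv0.
exists q; split=> //; apply: noncut_connect => //.
by apply: contraNneq vy => <-; rewrite connect_sym_adj.
Qed.

Lemma disk_sound : feasible ->
  (0 <= Num.max C.2 t)%R /\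
  two_connected (disk_graph (X ++ [:: C.1]) (Num.max C.2 t)).
Proof.
move=> ft; have conn := feasible_connected ft; have reach := disk_reach ft.
split.
  have [q [_ qC]] : exists q,
    connect (adj (del G [set Ordinal n0])) (Ordinal X2) q /\ (dist C.1 (pos X q) <= C.2)%R.
    exact: reach.
  by rewrite le_max (le_trans (dist_ge0 _ _) qC).
apply: (two_connected_disk_graph X2 conn _ _ reach).
  by move=> i j; rewrite short_edgesE => /andP[_ ij]; rewrite le_max ij orbT.
by rewrite le_max lexx.
Qed.

Section Network.
Context (s : R * R) (N : graph 'I_(size (X ++ [:: s]))) (tau : R).
Hypotheses (NT : verts N = setT) (tcN : two_connected N) (Ntau : (lmax N <= tau)%R).
Hypothesis rngG : forall i j : 'I_(size X),
  rng_adj i j -> (dist (pos X i) (pos X j) <= tau)%R -> adj G i j.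

Let conn := remove_connect X2 NT tcN Ntau rngG.

Lemma network_feasible : feasible.
Proof.
have F1 := (forest_connected short_forest n0).2 conn.
rewrite /feasible F1 orbF -leqNgt bC_val.
(* In a connected graph an isolated block is the only block, and the count is 2. Otherwise only leaf
   blocks are counted. *)
have [isol|/hasPn noisol] := boolP (has (fun B => ncuts cuts B == 0) blocks).
  have /hasP[B Bb B0] := isol.
  have nocut := forest_isolated short_forest conn Bb B0.
  have := (forest_single short_forest conn n0).2 nocut.
  by move: B0; case: blocks Bb => [|B' [|//]] //; rewrite inE => /eqP<- /eqP B0 _ /=; rewrite B0.
rewrite [X in _ + 2 * X](_ : _ = 0) ?addn0; last first.
  by apply/eqP; rewrite -leqn0 leqNgt -has_count; apply/hasPn.
rewrite leqNgt -size_filter; apply/negP; set LB := filter _ _ => LB6.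
have LBi (i : 'I_6) : nth [::] LB i \in LB by rewrite mem_nth // (leq_trans _ LB6).
have LBb B : B \in LB -> B \in blocks /\ ncuts cuts B == 1.
  by rewrite mem_filter => /andP[].
have /fin_all_exists[c lA] (i : 'I_6) : exists c, leaf G (vset _ (nth [::] LB i)) c.
  by have [Bb B1] := LBb _ (LBi i); apply: (forest_leafP short_forest Bb).1.
have /fin_all_exists[u uA] (i : 'I_6) : exists u, u \in vset _ (nth [::] LB i) :\ c i.
  exact: (leaf_interior conn (lA i)).
apply: (leaves_lt6 X2 NT tcN Ntau rngG (A := fun i => vset _ (nth [::] LB i)) _ lA uA).
have LBu : uniq (map (vset (size X)) LB).
  apply: subseq_uniq (forest_block_uniq short_forest).
  exact/map_subseq/filter_subseq.
move=> i j ij; apply/val_inj/eqP; have lt (k : 'I_6) : k < size LB := leq_trans (ltn_ord k) LB6.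
rewrite -(nth_uniq set0 _ _ LBu) ?size_map ?lt //.
by rewrite !(nth_map [::]) ?lt //; apply/eqP.
Qed.

(** For a block the radius is half an edge of length at most [t]. Otherwise the disk of radius
    [lmax N] about the Steiner point of [N] meets every leaf interior, so the smallest one is no
    larger. *)
Lemma network_disk : (C.2 <= Num.max (lmax N) t)%R.
Proof.
have [b1|nb1] := boolP (size blocks == 1).
  rewrite /disk_at /diskC b1 /=.
  have := pick_edge_spec Hpr (connected_short_edges conn).
  move: (pick_edge pr Et) => e; rewrite mem_filter => /andP[et _].
  have := dist_ge0 (pos X e.1) (pos X e.2); rewrite -/(edge_length X e) => e0.
  by rewrite le_max; apply/orP; right; lra.
have [_ smallest] := spanning_spec network_feasible nb1.
rewrite le_max (smallest s (lmax N)) // => k /mapP[[p k'] pQ ->].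
have [kb [c [u [lA uA _]]]] := (leaf_pointsE _ _).1 pQ.
have [q qA qs] := leaf_near_steiner X2 NT tcN Ntau rngG lA uA.
by exists (pos X q) => //; apply/leaf_pointsE; split=> //; exists c, q.
Qed.

End Network.

End Fixed.

(** * Soundness and completeness of the search *)

Section Search.
Context (L : seq R).
Hypotheses (L_sorted : sorted <=%R L) (LE : perm_eq L (map (edge_length X) E)).

Definition sound (best : option (candidate R)) :=
  if best is Some c then
    (0 <= c.1.1)%R /\ two_connected (disk_graph (X ++ [:: c.2]) c.1.1)
  else True.

Lemma better_sound new best : sound (Some new) -> sound best -> sound (better new best).
Proof. by case: best => //= c; case: ifP. Qed.

Lemma searchC_step fuel lo hi best : lo < hi ->
  (searchC pr X E L fuel.+1 lo hi best).1 =
  let m := median pr lo hi in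
  let t := nth 0%R L m in
  let best' := better (Num.max (disk_at t).2 t, t, (disk_at t).1) best in
  if feasible t then
    if ((disk_at t).2 <= t)%R then (searchC pr X E L fuel lo m best').1
    else (searchC pr X E L fuel m.+1 hi best').1
  else (searchC pr X E L fuel m.+1 hi best).1.
Proof.
move=> lohi; rewrite /feasible /disk_at /forest_at /= leqNgt lohi /=.
by case: (_ || _) => //=; case: ifP.
Qed.

Lemma searchC_sound fuel lo hi best :
  sound best -> sound (searchC pr X E L fuel lo hi best).1.
Proof.
elim: fuel lo hi best => [|fuel IHfuel] lo hi best sbest //.
have [hilo|lohi] := leqP hi lo; first by rewrite /= hilo.
rewrite searchC_step //=; set t := nth _ _ _.
case: ifP => [ft|_]; last exact: IHfuel.
have sbest' := @better_sound (Num.max (disk_at t).2 t, t, (disk_at t).1) best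
  (disk_sound ft) sbest.
by case: ifP => _; apply: IHfuel; apply: sbest'.
Qed.

Section Complete.
Context (s : R * R) (N : graph 'I_(size (X ++ [:: s]))).
Hypotheses (NT : verts N = setT) (tcN : two_connected N).
Local Notation tau := (lmax N).

Definition below (best : option (candidate R)) :=
  exists2 c, best = Some c & (c.1.1 <= tau)%R.

Lemma better_below new best :
  below best \/ (new.1.1 <= tau)%R -> below (better new best).
Proof.
case=> [[c -> ctau]|ntau] /=.
  by case: ifP => [/ltW nc|_]; [exists new => //; apply: le_trans nc ctau | exists c].
case: best => [c|] /=; last by exists new.
by case: ltP => [_|cn]; [exists new | exists c => //; apply: le_trans cn ntau].
Qed.

(** [R(tau)] is connected and so has an edge, whence some entry of [L] is at most [tau]; as [L] is
    sorted, these entries form an initial segment. *)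
Lemma last_below : exists j, j < size L /\
  forall k, k < size L -> (nth 0 L k <= tau)%R = (k <= j).
Proof.
have [|i [j ij]] := @connected_edge tau.
  apply: remove_connect X2 NT tcN (lexx _) _ => i j rij ij.
  by rewrite short_edgesE rij.
have {ij} : exists2 e, e \in E & (edge_length X e <= tau)%R.
  case/andP: ij => _ /orP[]; rewrite mem_filter => /andP[eN eE];
    by [exists (i : nat, j : nat) | exists (j : nat, i : nat)].
case=> e eE etau; have eL : edge_length X e \in L by rewrite (perm_mem LE) map_f.
pose P k := (k < size L) && (nth 0%R L k <= tau)%R.
have exP : exists k, P k.
  by exists (index (edge_length X e) L); rewrite /P index_mem eL nth_index.
have ubP k : P k -> k <= size L by case/andP => /ltnW.
case: (ex_maxnP exP ubP) => m /andP[mL mtau] maxm; exists m; split=> // k kL.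
apply/idP/idP => [ktau|km]; first by apply: maxm; rewrite /P kL.
apply: le_trans mtau; apply: (sorted_leq_nth le_trans le_refl) => //.
Qed.

(** No entry of [L] after position [j] is at most [tau], so the graph at position [m] contains all
    edges of the 2-RNG of length at most [max(tau, t)], even if [t < tau]. *)
Lemma network_threshold j m :
  (forall k, k < size L -> (nth 0 L k <= tau)%R = (k <= j)) ->
  j <= m -> m < size L ->
  feasible (nth 0%R L m) /\
  ((disk_at (nth 0 L m)).2 <= Num.max tau (nth 0 L m))%R.
Proof.
move=> jP jm mL; set t := nth _ _ _.
have rngG (a b : 'I_(size X)) : rng_adj a b ->
    (dist (pos X a) (pos X b) <= Num.max tau t)%R ->
    adj (graph_of (size X) (short_edges t)) a b.
  move=> rab; rewrite short_edgesE rab /= le_max => /orP[abtau|//].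
  have abL : dist (pos X a) (pos X b) \in L.
    rewrite (perm_mem LE); case: EX => _ /(_ a b) /=; rewrite rab.
    case/andP=> _ /orP[] abE; first by apply/mapP; exists (a : nat, b : nat).
    by apply/mapP; exists (b : nat, a : nat) => //; apply: dist_sym.
  have kL : index (dist (pos X a) (pos X b)) L < size L by rewrite index_mem.
  rewrite -(nth_index 0%R abL) in abtau *; move: abtau; rewrite jP // => kj.
  by apply: (sorted_leq_nth le_trans le_refl) => //; apply: leq_trans kj jm.
have taumax : (tau <= Num.max tau t)%R by rewrite le_max lexx.
split; first exact: (network_feasible NT tcN taumax rngG).
exact: (network_disk NT tcN taumax rngG).
Qed.

(** Invariant: a candidate of value at most [tau] has been found, or the last position [j] with
    length at most [tau] is still in the interval. The fuel exceeds the length of the interval,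
    which shrinks in every round. *)
Lemma searchC_complete fuel lo hi best :
  hi <= size L -> hi - lo < fuel ->
  below best \/ (exists2 j, lo <= j < hi &
    forall k, k < size L -> (nth 0 L k <= tau)%R = (k <= j)) ->
  below (searchC pr X E L fuel lo hi best).1.
Proof.
elim: fuel lo hi best => [|fuel IHfuel] lo hi best hiL lt_fuel inv //.
have [hilo|lohi] := leqP hi lo.
  by rewrite /= hilo; case: inv => // -[j]; lia.
rewrite searchC_step //=; set m := median pr lo hi.
have /andP[lom mhi] : lo <= m < hi := median_bounds Hpr lohi.
have mL : m < size L := leq_trans mhi hiL.
have inv' : below best \/ exists j, [/\ lo <= j, j < hi,
    forall k, k < size L -> (nth 0 L k <= tau)%R = (k <= j) &
    j <= m -> feasible (nth 0%R L m) /\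
  ((disk_at (nth 0 L m)).2 <= Num.max tau (nth 0 L m))%R].
  case: inv => [|[j /andP[loj jhi] jP]]; [by left | right].
  by exists j; split=> // jm; apply: (network_threshold jP jm mL).
set t := nth 0%R L m in inv' *.
(* An infeasible threshold lies before [j], which therefore stays in the upper part. *)
case: ifP => [ft|nft]; last first.
  apply: IHfuel => //; first lia.
  case: inv' => [|[j [loj jhi jP jm]]]; [by left | right; exists j => //].
  by rewrite jhi andbT ltnNge; apply: contraFN nft => /jm[].
set C := disk_at t in inv' *.
case: ifP => Ct; apply: IHfuel; try lia.
(* Here the value of the candidate is [t]. If it exceeds [tau], position [m] comes after [j]. *)
- have [ttau|taut] := leP t tau.
    by left; apply: better_below; right; rewrite /= ge_max ttau (le_trans Ct).
  case: inv' => [bb|[j [loj jhi jP jm]]]; first by left; apply: better_below; left.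
  right; exists j => //; rewrite loj ltnNge -jP // -ltNge; exact: taut.
(* Here the value is [C.2]. If it exceeds [tau], it exceeds [max(tau, t)], which is impossible from
   position [j] on. *)
- have [rtau|taur] := leP C.2 tau.
    left; apply: better_below; right; rewrite /= ge_max rtau /=.
    by apply: le_trans rtau; rewrite ltW // ltNge Ct.
  case: inv' => [bb|[j [loj jhi jP jm]]]; first by left; apply: better_below; left.
  right; exists j => //; rewrite jhi andbT ltnNge; apply/negP=> /jm[_].
  by rewrite leNgt gt_max taur ltNge Ct.
Qed.

End Complete.

Lemma search_optimal s (N : graph 'I_(size (X ++ [:: s]))) :
  verts N = setT -> two_connected N ->
  exists c, [/\ (searchC pr X E L (size L).+1 0 (size L) None).1 = Some c,
    two_connected (disk_graph (X ++ [:: c.2]) c.1.1) &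
    (lmax (disk_graph (X ++ [:: c.2]) c.1.1) <= lmax N)%R].
Proof.
move=> NT tcN; have [j [jL jP]] := last_below NT tcN.
have [|||c cE cN] := @searchC_complete _ _ NT tcN (size L).+1 0 (size L) None.
- by [].
- by rewrite subn0.
- by right; exists j.
have := @searchC_sound (size L).+1 0 (size L) None I.
rewrite cE => -[c0 tc]; exists c; split=> //.
exact: le_trans (lmax_disk_graph _ c0) cN.
Qed.

End Search.

End Threshold.

(** * Running time *)

(** A quadratic bound suffices, since the whole algorithm is allowed quadratic time. *)
Lemma msortC_rec_spec (R : realType) fuel (s : seq R) : size s <= fuel ->
  [/\ sorted <=%R (msortC_rec fuel s).1, perm_eq (msortC_rec fuel s).1 s &
      (msortC_rec fuel s).2 <= 4 * size s ^ 2 + 1].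
Proof.
elim: fuel s => [|fuel IHfuel] s /=.
  by rewrite leqn0 size_eq0 => /eqP ->.
move=> lt_s; case: (leqP (size s) 1) => [s1|s2] /=.
  split=> //; last by case: (size s) s1 => [|[]].
  by case: s s1 {lt_s} => [|x []].
have [|sort1 perm1 cost1] := IHfuel (take (size s)./2 s).
  by rewrite size_take; case: ifP; lia.
have [|sort2 perm2 cost2] := IHfuel (drop (size s)./2 s).
  by rewrite size_drop; lia.
split.
- by apply: merge_sorted => //; apply: le_total.
- rewrite perm_merge -[X in perm_eq _ X](cat_take_drop (size s)./2 s).
  exact: perm_cat.
- have sz : size (take (size s)./2 s) = (size s)./2.
    by rewrite size_take; case: ifP; lia.
  move: cost1 cost2; rewrite (perm_size perm1) (perm_size perm2) sz size_drop.
  by move: (msortC_rec _ _).2 (msortC_rec _ _).2 => a b; nia.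
Qed.

Lemma traverseC_cost (A B : Type) (f : A -> cost B) s :
  (traverseC f s).2 = \sum_(x <- s) ((f x).2 + 1) + 1.
Proof. by elim: s => [|x s IHs] /=; rewrite ?big_nil // big_cons IHs; lia. Qed.

Lemma traverse_concat_cost (A B : Type) (f : A -> cost (seq B)) s :
  let m := bind (traverseC f s) (fun ss => concatC ss) in
  m.2 = \sum_(x <- s) ((f x).2 + 1) + 1 + (size s + size m.1).+1.
Proof. by rewrite /= traverseC_cost traverseC_val size_map. Qed.

Lemma sum_nth_iota (T : Type) (x0 : T) (F : T -> nat) s :
  \sum_(x <- s) F x = \sum_(k <- iota 0 (size s)) F (nth x0 s k).
Proof. by rewrite (big_nth x0) /index_iota subn0. Qed.

Lemma nlogn_homo : {homo nlogn : m n / m <= n}.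
Proof. by move=> m n mn; rewrite leq_mul // ltnS leq_up_log. Qed.

Lemma leq_nlogn n : n <= nlogn n.
Proof. by rewrite leq_pmulr. Qed.

Lemma up_log2_le n : up_log 2 n <= n.
Proof. by apply: up_log_min => //; apply/ltnW/ltn_expl. Qed.

(** Lets logarithmically many rounds of cost [n log n] fit into quadratic time. *)
Lemma sqr_up_log2 n : 0 < n -> (up_log 2 n).+1 ^ 2 <= 8 * n.
Proof.
(* The exponent is [k.-1] because [2 ^ k] may exceed [n] when [k] is the rounded-up logarithm. *)
have sqr_exp k : k.+1 ^ 2 <= 8 * 2 ^ k.-1.
  elim: k => [//|[//|k IHk]]; rewrite /= in IHk *; rewrite expnS.
  case: k IHk => [//|k] IHk; rewrite !expnS /= in IHk *; nia.
case: n => [//|[|n]] _; first by rewrite up_log1.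
apply: leq_trans (sqr_exp _) _; rewrite leq_pmul2l //.
have := @up_log_bounds 2 n.+2 isT isT.
by case/andP=> /ltnW.
Qed.

(** * Cost of the search *)

Section SearchCost.
Context (R : realType) (pr : procedures R) (Hpr : known_procedures pr).
Context (X : seq (R * R)) (E : seq (nat * nat)) (X2 : 1 < size X).
Hypothesis EX : represents E (rng2_graph X).
Context (c2 c3 M : nat).
Hypothesis c2P : forall (n : nat) (E : seq (nat * nat)),
  0 < n -> edge_list n E -> (bcforestC pr n E).2 <= c2 * (n + size E).
Hypothesis c3P : forall Q : seq ((R * R) * nat),
  0 < size Q -> size (undup (map snd Q)) <= 5 ->
  (spanningC pr Q).2 <= c3 * nlogn (size Q).
Hypothesis MP : size X + 2 * size E <= M.

Section Fixed.
Context (t : R).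
Local Notation Et := (short_edges X E t).
Local Notation F := (forest_at pr X E t).
Local Notation blocks := (flatten (map fst F)).
Local Notation cuts := (flatten (map snd F)).

Let FG := short_forest Hpr X2 EX t.

Lemma short_size : size Et <= size E.
Proof. by rewrite size_filter count_size. Qed.

Lemma total_size : \sum_(B <- blocks) size B <= M.
Proof.
have := forest_total_size FG (short_edges_list EX t).
by have := short_size; lia.
Qed.

Lemma blocks_size : size blocks <= \sum_(B <- blocks) size B.
Proof.
rewrite -sum1_size [in X in X <= _]big_seq [in X in _ <= X]big_seq.
apply: leq_sum => B Bb; have [/set0Pn[u]] := forest_block_mclique FG Bb.
by rewrite inE; case: B {Bb}.
Qed.

Lemma bC_cost : (bC blocks cuts).2 <= 5 * M + 3.
Proof.
rewrite /bC /= traverseC_val !size_map traverseC_cost /=.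
have -> : \sum_(B <- blocks) ((size B).+1 + 1) =
    \sum_(B <- blocks) size B + 2 * size blocks.
  rewrite -sum1_size big_distrr -big_split /=; apply: eq_bigr => B _; lia.
by have := blocks_size; have := total_size; lia.
Qed.

Lemma leaf_points_size : size (leaf_pointsC X blocks cuts).1 <= \sum_(B <- blocks) size B.
Proof.
rewrite leaf_pointsC_val size_flatten /shape -map_comp sumnE big_map.
rewrite (sum_nth_iota [::]).
apply: leq_sum => k _ /=; case: ifP => // _.
by rewrite size_map size_filter count_size.
Qed.

Lemma leaf_points_cost : (leaf_pointsC X blocks cuts).2 <= 9 * M + 2.
Proof.
have := leaf_points_size; have := blocks_size; have := total_size.
rewrite /leaf_pointsC traverse_concat_cost size_iota; set f := (X in traverseC X _).
have cost_f k : (f k).2 <= 3 * size (nth [::] blocks k) + 3.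
  rewrite /f /=; case: ifP => _ /=; last by lia.
  rewrite size_filter; set a := count _ _.
  by have : a <= size (nth [::] blocks k) := count_size _ _; lia.
have : \sum_(k <- iota 0 (size blocks)) ((f k).2 + 1) <=
    3 * (\sum_(B <- blocks) size B) + 4 * size blocks.
  apply: leq_trans (_ : \sum_(B <- blocks) (3 * size B + 4) <= _).
    by rewrite (sum_nth_iota [::]); apply: leq_sum => k _; have := cost_f k; lia.
  by rewrite big_split -big_distrr big_const_seq count_predT iter_addn_0.
move=> f_le T_le nb_le Q_le;
apply: leq_trans (leq_add (leq_add f_le (leqnn 1)) (leq_add (leqnn (size blocks).+1) Q_le)) _.
by lia.
Qed.

Lemma disk_cost : feasible pr X E t ->
  (diskC pr X Et blocks cuts).2 <= 9 * M + 3 + c3 * nlogn M.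
Proof.
move=> ft; rewrite /diskC; case: ifP => [_|/negbT nb1]; first by rewrite /=; lia.
have [Q0 Q5] := leaf_points_spannable Hpr X2 EX ft nb1.
rewrite -[bind _ _]/(let Q := leaf_pointsC X blocks cuts in
  ((spanningC pr Q.1).1, Q.2 + (spanningC pr Q.1).2)) /snd.
apply: leq_add; first by apply: leq_trans leaf_points_cost _; rewrite leq_add2l.
apply: leq_trans (c3P Q0 Q5) _; rewrite leq_mul2l; apply/orP; right.
apply: nlogn_homo; exact: leq_trans leaf_points_size total_size.
Qed.

End Fixed.

(** A generous bound for one round without its recursive call; [M] also bounds the total size of the
    blocks. *)
Definition round_cost := 21 * M + 2 * c2 * M + 20 + c3 * nlogn M.

Lemma searchC_step_cost L fuel lo hi best : lo < hi ->
  (searchC pr X E L fuel.+1 lo hi best).2 =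
  let m := median pr lo hi in
  let t := nth 0%R L m in
  let C := disk_at pr X E t in
  let best' := better (Num.max C.2 t, t, C.1) best in
  let F := forest_at pr X E t in
  let blocks := flatten (map fst F) in
  let cuts := flatten (map snd F) in
  1 + ((size E).+1 + ((bcforestC pr (size X) (short_edges X E t)).2 +
  ((size (map fst F) + size blocks).+1 + ((size (map snd F) + size cuts).+1 +
  ((size X).+1 + ((bC blocks cuts).2 +
    if feasible pr X E t then
      (diskC pr X (short_edges X E t) blocks cuts).2 +
      if (C.2 <= t)%R then (searchC pr X E L fuel lo m best').2
      else (searchC pr X E L fuel m.+1 hi best').2
    else (searchC pr X E L fuel m.+1 hi best).2)))))).
Proof.
move=> lohi; rewrite /feasible /disk_at /forest_at /= leqNgt lohi /=.
by case: (_ || _) => //=; case: ifP.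
Qed.

(** Either choice of median leaves fewer than [2 ^ (j - 1)] positions on each side, hence there are
    at most [j] rounds. The extra 1 pays for the call that ends the search. *)
Lemma searchC_cost L fuel lo hi best j : hi - lo < 2 ^ j ->
  (searchC pr X E L fuel lo hi best).2 <= 1 + j * round_cost.
Proof.
elim: fuel lo hi best j => [//|fuel IHfuel] lo hi best j lt_j.
have [hilo|lohi] := leqP hi lo; first by rewrite /= hilo.
case: j lt_j => [|j]; first by rewrite expn0; lia.
rewrite expnS searchC_step_cost //; cbv zeta; have := median_bounds Hpr lohi.
set m := median pr lo hi; set t := nth _ _ _; set C := disk_at pr X E t.
move=> /andP[lom mhi] lt_j; have m_mid : m - lo < 2 ^ j /\ hi - m.+1 < 2 ^ j.
  by have := median_spec Hpr lohi; rewrite -/m; lia.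
have FG := short_forest Hpr X2 EX t.
have forest_cost := c2P (ltnW X2) (short_edges_list EX t).
have E_size := short_size t.
have cuts_size := forest_cuts_size FG.
have F_size := forest_size FG.
have block_size := blocks_size t; have tot_size := total_size t.
have b_cost := bC_cost t.
have c2M : c2 * (size X + size (short_edges X E t)) <= c2 * M.
  by rewrite leq_mul2l; apply/orP; right; lia.
set rest := (X in (bC _ _).2 + X).
have rest_cost : rest <= 9 * M + 3 + c3 * nlogn M + (1 + j * round_cost).
  rewrite /rest; case: ifP => [ft|_]; last first.
    by apply: leq_trans (IHfuel _ _ _ j _) (leq_addl _ _); lia.
  apply: leq_add; first exact: disk_cost.
  by case: ifP => _; apply: IHfuel; lia.
have costs : forall a b' nb' nc' p p' q r : nat, a <= size E -> b' <= c2 * M ->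
    p <= size X -> p' <= size X -> nb' <= M -> nc' <= size X -> q <= 5 * M + 3 ->
    r <= 9 * M + 3 + c3 * nlogn M + (1 + j * round_cost) ->
    1 + (a.+1 + (b' + ((p + nb').+1 + ((p' + nc').+1 + ((size X).+1 + (q + r)))))) <=
    1 + j.+1 * round_cost.
  by move=> *; rewrite mulSn {1}/round_cost; lia.
apply: costs => //; rewrite ?size_map //.
- exact: leq_trans forest_cost c2M.
- exact: leq_trans block_size tot_size.
Qed.

End SearchCost.

(** [is_MBSN] places its graphs on [P ++ [::]]; this moves them to [P]. *)
Lemma mbsn0_cats0 (R : realType) (P : seq (R * R)) (E : seq (nat * nat)) :
  is_MBSN 0 P [::] (graph_of _ E) ->
  two_connected (graph_of (size P) E) /\
  forall N : graph 'I_(size P), verts N = setT -> two_connected N ->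
    (@lmax R P (graph_of (size P) E) <= lmax N)%R.
Proof.
case=> _ _ tc opt; split; first by rewrite cats0 in tc.
have {tc} := opt [::]; rewrite cats0 => {}opt N; exact: opt.
Qed.

(** With [l] the logarithmic factor, [l] rounds of cost [O(M l)] make [O(M l^2)], and [l^2] is at
    most [8 M]. *)
Lemma round_cost_total c2 c3 M : 0 < M ->
  (up_log 2 M).+1 * round_cost c2 c3 M <= 8 * (41 + 2 * c2 + c3) * M ^ 2.
Proof.
move=> M0; have sqr := sqr_up_log2 M0; have := leq_nlogn M.
rewrite /round_cost /nlogn; move: (up_log 2 M).+1 sqr => l sqr Ml.
have le1 : 21 * M + 2 * c2 * M + 20 + c3 * (M * l) <= (41 + 2 * c2 + c3) * (M * l).
  by nia.
apply: leq_trans (leq_mul (leqnn l) le1) _.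
have -> : l * ((41 + 2 * c2 + c3) * (M * l)) = (41 + 2 * c2 + c3) * M * l ^ 2 by ring.
have -> : 8 * (41 + 2 * c2 + c3) * M ^ 2 = (41 + 2 * c2 + c3) * M * (8 * M) by ring.
by rewrite leq_mul2l sqr orbT.
Qed.

Lemma nlognS_le n : 0 < n -> nlogn n.+1 <= 6 * n ^ 2.
Proof.
move=> n0; have -> : 6 * n ^ 2 = (2 * n) * (3 * n) by ring.
by apply: leq_mul; [lia | have := up_log2_le n.+1; lia].
Qed.

Lemma leq_sum7 (x1 x2 x3 x4 x5 x6 x7 k1 k2 k3 k4 k5 k6 k7 m : nat) :
  x1 <= k1 * m -> x2 <= k2 * m -> x3 <= k3 * m -> x4 <= k4 * m ->
  x5 <= k5 * m -> x6 <= k6 * m -> x7 <= k7 * m ->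
  x1 + (x2 + (x3 + (x4 + (x5 + (x6 + x7))))) <=
  (k1 + k2 + k3 + k4 + k5 + k6 + k7) * m.
Proof. by move=> *; rewrite !mulnDl -!addnA; do !apply: leq_add. Qed.

(** The computed centre may coincide with one point of [X]. *)
Lemma uniq_at_most_twice (R : realType) (X : seq (R * R)) s :
  uniq X -> at_most_twice (X ++ [:: s]).
Proof.
move=> Xu p; rewrite count_cat /= (count_uniq_mem _ Xu).
by case: (p \in X); case: (s == p).
Qed.

Theorem theorem12 (R : realType) (pr : procedures R)
  (Hpr : known_procedures pr) :
  exists K : nat, forall X : seq (R * R),
    uniq X -> 2 <= size X ->
    let s := (algorithm1 pr X).1.1 in
    let N := (algorithm1 pr X).1.2 in
    let time := (algorithm1 pr X).2 in
    [/\ edge_list (size (X ++ [:: s])) N,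
        is_MBSN 1 X [:: s] (graph_of (size (X ++ [:: s])) N) &
        time <= K * size X ^ 2].
Proof.
have [c0 c0P] := rng2C_spec Hpr; have [c1 c1P] := mbsn0C_spec Hpr.
have [c2 c2P] := bcforestC_spec Hpr; have [c3 c3P] := spanningC_spec Hpr 5.
(* The 2-RNG has at most [c0 * n] edges, so [d * n] bounds its vertices plus twice its edges. *)
pose d := 2 * c0 + 1.
(* The summands pay for the 2-RNG of [X], its edge lengths, sorting, the search, appending the
   centre, the 2-RNG of [Y] and the final network. *)
exists (c0 + (c0 + 1) + (4 * c0 ^ 2 + 1) +
  (1 + 8 * (41 + 2 * c2 + c3) * d ^ 2) + 2 + 4 * c0 + 6 * c1).
move=> X Xu X2 s N time.
have n0 : 0 < size X := ltnW X2.
have X_twice : at_most_twice X.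
  by move=> p; rewrite (count_uniq_mem _ Xu); case: (p \in X).
have [EX E_size E_cost] := c0P X n0 X_twice.
set E := (rng2C pr X).1 in EX E_size.
have [L_sorted L_perm L_cost] := msortC_rec_spec (leqnn (size (map (edge_length X) E))).
set L := (msortC_rec _ _).1 in L_sorted L_perm.
pose best := searchC pr X E L (size L).+1 0 (size L) None.
have sE : s = if best.1 is Some c then c.2 else (0, 0)%R by [].
pose Y := X ++ [:: s].
have Y_size : size Y = (size X).+1 by rewrite size_steiner.
have Y0 : 0 < size Y by rewrite Y_size.
have [EY _ EY_cost] := c0P Y Y0 (uniq_at_most_twice s Xu).
have [N_list N_mbsn N_cost] := c1P Y _ Y0 (uniq_at_most_twice s Xu) EY.
have NE : N = (mbsn0C pr Y (rng2C pr Y).1).1 by [].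
have [N_tc N_opt] := mbsn0_cats0 N_mbsn.
split; first exact: N_list.
  (* A competitor [N'] has exactly one Steiner point [s']. The search yields a 2-connected disk
     graph on [Y] no worse than [N'], and the output is optimal on [Y]. *)
  split=> // [[|s' [|//]]] N' // _ N'T N'_tc.
  have [c [bestE c_tc c_opt]] := search_optimal Hpr X2 EX L_sorted L_perm N'T N'_tc.
  have sc : s = c.2 by rewrite sE /best bestE.
  rewrite -sc in c_tc c_opt; apply: le_trans c_opt; exact: N_opt.
have timeE : time = (rng2C pr X).2 + ((size E).+1 +
    ((msortC (map (edge_length X) E)).2 + (best.2 + ((size X).+1 +
    ((rng2C pr Y).2 + (mbsn0C pr Y (rng2C pr Y).1).2))))).
  by rewrite -[(mbsn0C _ _ _).2]addn0.
have best_cost : best.2 <= 1 + 8 * (41 + 2 * c2 + c3) * (d * size X) ^ 2.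
  have d_size : size X + 2 * size E <= d * size X by rewrite /d; nia.
  have d0 : 0 < d * size X by rewrite /d; nia.
  have c2P' n E' n0' El := proj2 (c2P n E' n0' El).
  have c3P' Q Q0 Q5 := proj2 (c3P Q Q0 Q5).
  (* The successor in the exponent makes the bound by the rounded-up logarithm strict. *)
  have L_lt : size L - 0 < 2 ^ (up_log 2 (d * size X)).+1.
    rewrite subn0 (perm_size L_perm) size_map.
    apply: (@leq_ltn_trans (d * size X)); first by lia.
    apply: leq_ltn_trans (up_logP (d * size X) (isT : 1 < 2)) _.
    by rewrite ltn_exp2l.
  apply: leq_trans (searchC_cost Hpr X2 EX c2P' c3P' d_size _ _ _ L_lt) _.
  by rewrite leq_add2l; apply: round_cost_total.
have Y_log : nlogn (size Y) <= 6 * size X ^ 2 by rewrite Y_size; apply: nlognS_le.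
have EY_cost' : (rng2C pr Y).2 <= 4 * c0 * size X ^ 2.
  apply: leq_trans EY_cost _; rewrite Y_size -mulnA mulnCA leq_mul2l; apply/orP; right.
  by rewrite -(expnMn 2 _ 2) leq_exp2r //; lia.
have N_cost' : (mbsn0C pr Y (rng2C pr Y).1).2 <= 6 * c1 * size X ^ 2.
  by apply: leq_trans N_cost _; rewrite [6 * c1]mulnC -mulnA leq_mul2l Y_log orbT.
have sqr_size : size X <= size X ^ 2 by rewrite expnS expn1 leq_pmulr.
have sqr_gt0 : 0 < size X ^ 2 := leq_trans n0 sqr_size.
have E_cost' : (size E).+1 <= (c0 + 1) * size X ^ 2.
  rewrite mulnDl mul1n -addn1; apply: leq_add => //.
  by apply: leq_trans E_size _; rewrite leq_mul2l sqr_size orbT.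
have L_cost' : (msortC [seq edge_length X e | e <- E]).2 <= (4 * c0 ^ 2 + 1) * size X ^ 2.
  apply: leq_trans L_cost _; rewrite size_map mulnDl mul1n; apply: leq_add => //.
  by rewrite -mulnA -expnMn leq_mul2l leq_exp2r.
have best_cost' : best.2 <= (1 + 8 * (41 + 2 * c2 + c3) * d ^ 2) * size X ^ 2.
  apply: leq_trans best_cost _; rewrite mulnDl mul1n; apply: leq_add => //.
  by rewrite expnMn mulnA.
have X_cost : (size X).+1 <= 2 * size X ^ 2 by lia.
rewrite timeE; exact: leq_sum7.
Qed.
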